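(* For every $\varepsilon>0$ there exists $x_0$ such that for all real $x\ge x_0$, $$\omega\left(\prod_{\substack{p<x^{1/3}\\ \tau(p)\neq 0}}\tau(p)\tau(p^2)\tau(p^3)\right)\geq \left(\frac{1}{6\log 7}-\varepsilon\right) \log x,$$ where the product is over primes $p<x^{1/3}$ with $\tau(p)\ne 0$. (In the paper's notation: the left side is at least $\left(\frac{1}{6\log 7}+o(1)\right)\log x$ as $x\to\infty$.)
   Context: $\tau(n)$ denotes the Ramanujan function, defined by the power series identity $X\prod_{n=1}^\infty(1-X^n)^{24}=\sum_{n=1}^\infty \tau(n)X^n$ for $|X|<1$. For an integer $m$, $\omega(m)$ denotes the number of distinct prime factors of $m$, with the convention $\omega(0)=\omega(\pm1)=0$. The letter $p$ denotes a prime. *)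

(* Defs.v *)
From HB Require Import structures.
From mathcomp Require Import all_boot all_order all_algebra.
From mathcomp Require Import all_classical all_reals all_analysis.
From mathcomp Require Import ring lra.

Set Implicit Arguments.
Unset Strict Implicit.
Unset Printing Implicit Defensive.

Import Order.TTheory GRing.Theory Num.Theory.
Import numFieldNormedType.Exports.

Local Open Scope classical_set_scope.
Local Open Scope ring_scope.

Definition delta_trunc (A : comNzRingType) (N : nat) : {poly A} :=
  'X * \prod_(1 <= k < N.+1) (1 - 'X^k) ^+ 24.

(* Factors with k > n do not affect the coefficient of X^n, so this is the
   coefficient in the infinite product; [tau_power_series] below shows that the
   defining identity X \prod (1 - X^n)^24 = \sum tau(n) X^n holds analytically
   on |X| < 1. The identity starts at n = 1; here tau 0 = 0. *)
Definition tau (n : nat) : int := (delta_trunc int n)`_n.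

(* Number of distinct prime factors; since primes 0 = primes 1 = [::], this
   gives omega 0 = omega (+-1) = 0. *)
Definition omega (m : int) : nat := size (primes `|m|%N).

Lemma tau0 : tau 0 = 0.
Proof. by rewrite /tau /delta_trunc big_geq// mulr1 coefX. Qed.

Lemma coef_mul_trunc (A : comNzRingType) (p : {poly A}) m j n : (n < m)%N ->
  (p * (1 - 'X^m) ^+ j)`_n = p`_n.
Proof.
move=> nm; elim: j => [|j IH]; first by rewrite expr0 mulr1.
by rewrite exprSr mulrA mulrBr mulr1 coefB coefMXn nm subr0.
Qed.

Lemma coef_delta_trunc (A : comNzRingType) n N : (n <= N)%N ->
  (delta_trunc A N)`_n = (delta_trunc A n)`_n.
Proof.
elim: N => [|N IH]; first by rewrite leqn0 => /eqP->.
rewrite leq_eqVlt => /predU1P[->//|nN].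
by rewrite /delta_trunc big_nat_recr//= mulrA coef_mul_trunc// IH.
Qed.

Lemma map_delta_trunc (A : comNzRingType) N :
  map_poly (intmul 1) (delta_trunc int N) = delta_trunc A N.
Proof.
rewrite /delta_trunc rmorphM/= map_polyX rmorph_prod; congr (_ * _).
by apply: eq_bigr => k _; rewrite rmorphXn/= rmorphB/= rmorph1 map_polyXn.
Qed.

Lemma delta_trunc_tau (A : comNzRingType) N n : (n <= N)%N ->
  (delta_trunc A N)`_n = (tau n)%:~R.
Proof. by move=> nN; rewrite -map_delta_trunc coef_map/= (coef_delta_trunc _ nN). Qed.

Section Dominate.
Variable R : realType.
Implicit Types p q : {poly R}.

Let dom p q := forall n, `|p`_n| <= q`_n.

Let domM p q p' q' : dom p q -> dom p' q' -> dom (p * p') (q * q').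
Proof.
move=> pq pq' n; rewrite !coefM (le_trans (ler_norm_sum _ _ _))//.
by apply: ler_sum => i _; rewrite normrM ler_pM.
Qed.

Let dom1 : dom 1 1.
Proof. by move=> n; rewrite coef1; case: eqP => _; rewrite ?normr1 ?normr0. Qed.

Let domX : dom 'X 'X.
Proof. by move=> n; rewrite coefX; case: eqP => _; rewrite ?normr1 ?normr0. Qed.

Let dom1X k : dom (1 - 'X^k) (1 + 'X^k).
Proof.
move=> n; rewrite coefB coefD (le_trans (ler_normB _ _))//.
by rewrite lerD// ?coefXn ?coef1 normr_nat.
Qed.

Let maj N : {poly R} := 'X * \prod_(1 <= k < N.+1) (1 + 'X^k) ^+ 24.

Let dom_eta N : dom (delta_trunc R N) (maj N).
Proof.
apply: domM => //; elim/big_ind2: _ => // [? ? ? ? ? ?|k _]; first exact: domM.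
have H j : dom ((1 - 'X^k) ^+ j) ((1 + 'X^k) ^+ j).
  elim: j => [|j IH]; first by rewrite !expr0.
  by rewrite !exprS; exact: domM.
exact: H.
Qed.

Let maj_ge0 N n : 0 <= (maj N)`_n.
Proof. by rewrite (le_trans _ (dom_eta N n)). Qed.

Let B (y : R) := expR ((y / (1 - y)) *+ 24).

Let maj_le N (y : R) : 0 < y < 1 -> (maj N).[y] <= B y.
Proof.
move=> /andP[y0 y1]; rewrite /maj hornerM hornerX horner_prod.
have y0' := ltW y0; have y1' := ltW y1.
apply: (@le_trans _ _ (\prod_(1 <= k < N.+1) (expR (y ^+ k) ^+ 24))).
  rewrite -[leRHS]mul1r; apply: ler_pM => //.
    apply: prodr_ge0 => k _; rewrite horner_exp ?exprn_ge0//.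
    by rewrite !hornerE addr_ge0// ?exprn_ge0.
  apply: ler_prod => k _; rewrite horner_exp !hornerE.
  have h : 0 <= 1 + y ^+ k by rewrite addr_ge0// ?exprn_ge0.
  by rewrite ?exprn_ge0//= lerXn2r ?nnegrE ?expR_ge0// expR_ge1Dx.
under eq_bigr do rewrite -expRM_natl mulr_natl.
rewrite -expR_sum ler_expR sumrMnl lerMn2r; apply/orP; right.
rewrite -(addn1 N) addnC geometric_partial_tail expr1.
by rewrite geometric_le_lim// ger0_norm.
Qed.

Let coef_le N n (y : R) : 0 < y < 1 -> `|(delta_trunc R N)`_n| * y ^+ n <= B y.
Proof.
move=> y01; have /andP[y0 _] := y01; have y0' := ltW y0.
apply: le_trans (maj_le N y01).
apply: (@le_trans _ _ ((maj N)`_n * y ^+ n)).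
  by rewrite ler_wpM2r ?exprn_ge0 ?dom_eta.
rewrite (@horner_coef_wide _ (size (maj N) + n.+1) (maj N))// ?leq_addr//.
have hn : (n < size (maj N) + n.+1)%N by rewrite addnS ltnS leq_addl.
rewrite (bigD1 (Ordinal hn))//= lerDl sumr_ge0// => i _.
by rewrite mulr_ge0// ?exprn_ge0.
Qed.

Lemma tau_power_series (x : R) : `|x| < 1 -> exists s : R,
  (fun N => x * \prod_(1 <= k < N.+1) (1 - x ^+ k) ^+ 24) @ \oo --> s /\
  series (fun n => (tau n)%:~R * x ^+ n) @ \oo --> s.
Proof.
move=> x1; pose a n : R := (tau n)%:~R * x ^+ n.
pose y := (`|x| + 1) / 2; have x0 := normr_ge0 x.
have y0 : 0 < y by rewrite divr_gt0// ltr_wpDl.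
have y1 : y < 1 by rewrite /y ltr_pdivrMr// mul1r; lra.
have y01 : 0 < y < 1 by rewrite y0.
have y1' : `|y| < 1 by rewrite gtr0_norm.
have xy : `|x| <= y * y.
  have : 0 <= ((1 - `|x|) / 2) ^+ 2 by rewrite sqr_ge0.
  rewrite /y !expr2; nra.
have key N n : `|(delta_trunc R N)`_n * x ^+ n| <= geometric (B y) y n.
  rewrite normrM normrX /geometric/=.
  apply: (@le_trans _ _ (`|(delta_trunc R N)`_n| * (y * y) ^+ n)).
    by rewrite ler_wpM2l// lerXn2r// nnegrE mulr_ge0// ltW.
  by rewrite exprMn mulrA ler_wpM2r ?coef_le// ?exprn_ge0// ltW.
have cva : cvgn (series a).
  apply: normed_cvg.
  apply: (@series_le_cvg _ _ (geometric (B y) y)) => [n|n|n|] //=.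
  - by rewrite mulr_ge0 ?expR_ge0// ?exprn_ge0// ltW.
  - by rewrite /a -(delta_trunc_tau _ (leqnn n)).
  - exact: is_cvg_geometric_series.
exists (limn (series a)); split => //.
have -> : (fun N => x * \prod_(1 <= k < N.+1) (1 - x ^+ k) ^+ 24) =
    (fun N => series a N.+1) \+ (fun N => (delta_trunc R N).[x] - series a N.+1).
  apply/funext => N /=; rewrite addrC subrK /delta_trunc hornerM hornerX horner_prod.
  by congr (_ * _); apply: eq_bigr => k _; rewrite horner_exp !hornerE.
rewrite -[X in _ --> X]addr0; apply: cvgD.
  by rewrite (cvg_shiftS (series a)).
apply/norm_cvg0P.
apply: (@squeeze_cvgr _ _ _ _ (fun=> 0)
  (fun N => B y * (y ^+ N.+1 / (1 - y)))); last 2 first.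
- exact: cvg_cst.
- rewrite -[X in _ --> X](mulr0 (B y)); apply: cvgMl_tmp => //.
  rewrite -[X in _ --> X](mul0r (1 - y)^-1); apply: cvgMr_tmp => //.
  have := cvg_geometric (1 : R) y1'; rewrite -cvg_shiftS.
  by apply: cvg_trans; apply: near_eq_cvg; near=> n; rewrite /= mul1r.
near=> N; rewrite normr_ge0/=.
set m := size (delta_trunc R N).
rewrite (@horner_coef_wide _ (N.+1 + m) (delta_trunc R N)) ?leq_addl//.
rewrite -(big_mkord xpredT (fun i => (delta_trunc R N)`_i * x ^+ i)).
rewrite (@big_cat_nat _ _ _ N.+1) ?leq_addr//=.
rewrite (_ : \sum_(0 <= i < N.+1) _ = series a N.+1); last first.
  rewrite /series/= !big_nat; apply: eq_bigr => i; rewrite ltnS => /andP[_ iN].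
  by rewrite delta_trunc_tau.
rewrite [_ + _ in X in X - _]addrC addrK (le_trans (ler_norm_sum _ _ _))//.
apply: (@le_trans _ _ (\sum_(N.+1 <= i < N.+1 + m) B y * y ^+ i)).
  by apply: ler_sum => i _; exact: key.
rewrite -mulr_sumr ler_wpM2l ?expR_ge0// geometric_partial_tail.
by rewrite geometric_le_lim// ?exprn_ge0// ltW.
Unshelve. all: by end_near.
Qed.

End Dominate.

(* Main.v *)
(* The Hecke relations give tau(p^2) = tau(p)^2 - p^11 and
   tau(p^3) = tau(p) (tau(p)^2 - 2 p^11), so none of the factors vanishes once
   tau(p) <> 0, and p can be recovered from the pair (tau(p), tau(p^2)). If S is
   the set of primes dividing the product, then for each p = 1 mod 3 below M^54
   both members of the pair are S-smooth and bounded by a fixed power of M. By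
   Rankin's trick a set of o(log M) primes leaves only M^o(1) such pairs, whereas
   there are more than M primes p = 1 mod 3 below M^54, since these are the only
   primes dividing the product of the 9 k^2 + 3 k + 1 for k <= N; and tau(p) <> 0
   for them by a congruence modulo 9. Hence |S| exceeds any multiple of log x.

   Everything about tau is derived from its product without complex analysis.
   Liouville's elementary method evaluates convolutions of divisor sums, which
   yields Ramanujan's differential equations for the truncated Eisenstein series
   and with them a formula for tau in terms of divisor sums. The modular symbol
   attached to the period polynomial of weight 12 is defined by the Euclidean
   algorithm; the space of such symbols is one-dimensional, so Hecke operators
   act on it by scalars, and Merel's formula together with Liouville's method
   identifies the eigenvalue of T_n, for n a prime power, with tau(n). *)

Require Import Defs.
From mathcomp Require Import all_boot all_order all_algebra.
From mathcomp Require Import all_classical all_reals all_analysis.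
From mathcomp Require Import ring lra zify.
From mathcomp Require cyclic.

Set Implicit Arguments.
Unset Strict Implicit.
Unset Printing Implicit Defensive.

Import Order.TTheory GRing.Theory Num.Theory.

Local Open Scope ring_scope.

(** Two sums over the quadruples a v + u c = n have to be matched. One comes from the bracket 3 R X
    Q' - 2 Q X R', which equals Q^3 - R^2 but is only quadratic in the Eisenstein series, so that it
    expresses tau(n) by a polynomial summed over such quadruples; expanding Q^3 would lead to triple
    convolutions. The other is the coefficient of X^9 Y in Merel's sum: a matrix with c > 0 turns
    into a quadruple under u = a - b, v = d - c. Up to a factor the two polynomials differ by
    [H - shear H] with H symmetric, and the bijection (a, u, c, v) -> (a - u, u, c + v, v) reduces
    the sum of such a difference to power sums over divisors. Modular symbols matter only up to a
    function of X and Y that does not depend on the cusp. This ambiguity is carried along as an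
    existential [K]; it cancels in the jump from 1 / 0 to 0 / 1, from which eigenvalues are read
    off. The constants of the counting part may be crude, because Rankin's trick is available for
    every exponent d > 0. *)

Lemma big_seq_bij (V : nmodType) (I J : eqType) (s : seq I) (t : seq J)
    (P : pred I) (Q : pred J) (f : I -> J) (g : J -> I) (F : I -> V) (G : J -> V) :
  uniq s -> uniq t ->
  (forall i, i \in s -> P i -> [/\ f i \in t, Q (f i), g (f i) = i & F i = G (f i)]) ->
  (forall j, j \in t -> Q j -> [/\ g j \in s, P (g j) & f (g j) = j]) ->
  \sum_(i <- s | P i) F i = \sum_(j <- t | Q j) G j.
Proof.
move=> us ut sP tQ; rewrite -big_filter -[RHS]big_filter.
have sfP i : i \in seq.filter P s -> i \in s /\ P i by rewrite mem_filter => /andP[].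
rewrite (perm_big (map f (seq.filter P s))) /=; last first.
  apply: uniq_perm; first exact: filter_uniq.
    rewrite map_inj_in_uniq ?filter_uniq// => i j /sfP[si Pi] /sfP[sj Pj] e.
    by have [_ _ <- _] := sP _ si Pi; have [_ _ <- _] := sP _ sj Pj; rewrite e.
  move=> j; rewrite mem_filter; apply/andP/mapP => [[Qj tj]|[i /sfP[si Pi] ->]].
    have [sg Pg e] := tQ _ tj Qj; exists (g j) => //.
    by rewrite mem_filter sg Pg.
  by have [] := sP _ si Pi.
rewrite big_map; apply: eq_big_seq => i /sfP[si Pi].
by have [] := sP _ si Pi.
Qed.

(** * Liouville's elementary method *)

Definition pairs n : seq (nat * nat) :=
  [seq (i, j) | i <- iota 0 n.+1, j <- iota 0 n.+1].

Lemma mem_pairs n p : (p \in pairs n) = ((p.1 <= n) && (p.2 <= n))%N.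
Proof.
case: p => i j; apply/allpairsP/andP => [[[x y] [+ + [-> ->]]]|[hi hj]].
  by rewrite !mem_iota.
by exists (i, j); rewrite !mem_iota.
Qed.

Lemma pairs_uniq n : uniq (pairs n).
Proof. by apply: allpairs_uniq; rewrite ?iota_uniq// => -[? ?] [? ?]. Qed.

(* Without the test [0 < n], (0, 0) would be listed for n = 0. *)
Definition factor_pairs n := [seq p <- pairs n | (0 < n)%N && (p.1 * p.2 == n)%N].

Lemma mem_factor_pairs n p :
  (p \in factor_pairs n) = [&& (0 < p.1)%N, (0 < p.2)%N & (p.1 * p.2 == n)%N].
Proof.
rewrite mem_filter mem_pairs; case: p => a b /=.
apply/andP/and3P => [[/andP[n0 /eqP e] _]|[a0 b0 /eqP <-]].
  by split; [nia..|exact/eqP].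
by rewrite eqxx muln_gt0 a0 b0 leq_pmulr// leq_pmull.
Qed.

Lemma factor_pairs_uniq n : uniq (factor_pairs n).
Proof. exact/filter_uniq/pairs_uniq. Qed.

(* The quadruple ((a, v), (u, c)) encodes n = a v + u c; [lsum] below reads it
   in the order a, u, c, v. *)
Definition liouville n : seq ((nat * nat) * (nat * nat)) :=
  [seq q <- [seq (x, y) | x <- pairs n, y <- pairs n] |
    [&& 0 < q.1.1, 0 < q.1.2, 0 < q.2.1, 0 < q.2.2 &
        q.1.1 * q.1.2 + q.2.1 * q.2.2 == n]%N].

Lemma mem_liouville n q : (q \in liouville n) =
  [&& 0 < q.1.1, 0 < q.1.2, 0 < q.2.1, 0 < q.2.2 &
        q.1.1 * q.1.2 + q.2.1 * q.2.2 == n]%N.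
Proof.
rewrite mem_filter andb_idr//; case: q => [[a v] [u c]] /and5P[a0 v0 u0 c0 /eqP e].
by apply/allpairsP; exists ((a, v), (u, c)); rewrite !mem_pairs; split=> //=; move: a0 v0 u0 c0 e => /=; nia.
Qed.

Lemma liouville_uniq n : uniq (liouville n).
Proof.
apply: filter_uniq; apply: allpairs_uniq; rewrite ?pairs_uniq//.
by move=> -[? ?] [? ?].
Qed.

Section LiouvilleIdentity.
Variable n : nat.
Implicit Types H F : int -> int -> int -> int -> int.

Definition lsum (C : pred ((nat * nat) * (nat * nat))) H :=
  \sum_(q <- liouville n | C q) H q.1.1%:Z q.2.1%:Z q.2.2%:Z q.1.2%:Z.

Definition swap_sym H := forall a u c v, H u a v c = H a u c v.
(** A substitution that preserves the equation, since a v + u c = (a - u) v + u (c + v). *)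
Definition shear H a u c v := H (a - u) u (c + v) v.

Lemma lsum_eq C H F : (forall a u c v, H a u c v = F a u c v) -> lsum C H = lsum C F.
Proof. by move=> HF; apply: eq_bigr => q _; exact: HF. Qed.

Lemma lsum_swap C C' H : (forall q, C (q.2, q.1) = C' q) ->
  lsum C H = lsum C' (fun a u c v => H u a v c).
Proof.
move=> CC'; apply: (@big_seq_bij _ _ _ _ _ _ _ (fun q => (q.2, q.1)) (fun q => (q.2, q.1)));
  rewrite ?liouville_uniq// => -[[a v] [u c]];
  rewrite mem_liouville /= => /and5P[a0 v0 u0 c0].
  move=> e Cq; split; [by rewrite mem_liouville /= addnC e; apply/and5P| |by []|by []].
  by rewrite -CC'.
move=> e Cq; split; [by rewrite mem_liouville /= addnC e; apply/and5P| |by []].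
by rewrite (CC' (a, v, (u, c))).
Qed.

Lemma lsum_shear H :
  lsum (fun q => q.2.1 < q.1.1)%N (shear H) = lsum (fun q => q.1.2 < q.2.2)%N H.
Proof.
apply: (@big_seq_bij _ _ _ _ _ _ _
  (fun q => ((q.1.1 - q.2.1, q.1.2), (q.2.1, q.2.2 + q.1.2))%N)
  (fun q => ((q.1.1 + q.2.1, q.1.2), (q.2.1, q.2.2 - q.1.2))%N));
  rewrite ?liouville_uniq// => -[[a v] [u c]]; rewrite !mem_liouville /=
  => /and5P[a0 v0 u0 c0 /eqP e] h; split.
- by apply/and5P; split; try apply/eqP; nia.
- lia.
- by congr (_, _, (_, _)); lia.
- by rewrite /shear; congr H; lia.
- by apply/and5P; split; try apply/eqP; nia.
- lia.
- by congr (_, _, (_, _)); lia.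
Qed.

Lemma lsum_split3 (f g : ((nat * nat) * (nat * nat)) -> nat) H :
  lsum predT H = lsum (fun q => f q < g q)%N H + lsum (fun q => g q < f q)%N H
                 + lsum (fun q => f q == g q) H.
Proof.
rewrite /lsum (bigID (fun q => f q < g q)%N)/= -addrA; congr (_ + _).
rewrite (bigID (fun q => g q < f q)%N)/=; congr (_ + _); apply: eq_bigl => q.
  by case: ltngtP.
by case: ltngtP.
Qed.

Lemma lsum_gt2 H : swap_sym H ->
  lsum (fun q => q.2.1 < q.1.1)%N H *+ 2 =
  lsum predT H - lsum (fun q => q.1.1 == q.2.1) H.
Proof.
move=> sH; rewrite (lsum_split3 (fun q => q.1.1) (fun q => q.2.1)) addrK mulr2n.
congr (_ + _); rewrite (@lsum_swap _ (fun q => q.1.1 < q.2.1)%N) //.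
by apply: lsum_eq => *; exact: sH.
Qed.

(** The bijection turns the condition u < a into v < c. By symmetry each of them selects half of the
    quadruples off its diagonal a = u or v = c, so after doubling only the two diagonals remain. *)
Lemma liouville_identity H : swap_sym H ->
  (lsum (fun q => q.2.1 < q.1.1)%N H - lsum (fun q => q.2.1 < q.1.1)%N (shear H)) *+ 2
  = lsum (fun q => q.1.2 == q.2.2) H - lsum (fun q => q.1.1 == q.2.1) H.
Proof.
move=> sH; rewrite mulrnBl lsum_gt2// lsum_shear mulr2n.
have e : lsum (fun q => q.1.2 < q.2.2)%N H = lsum (fun q => q.2.2 < q.1.2)%N H.
  by rewrite (@lsum_swap _ (fun q => q.2.2 < q.1.2)%N) //; apply: lsum_eq => *; exact: sH.
by rewrite {2}e; rewrite {1}(lsum_split3 (fun q => q.1.2) (fun q => q.2.2)); ring.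
Qed.

Lemma lsumD C H F : lsum C (fun a u c v => H a u c v + F a u c v) = lsum C H + lsum C F.
Proof. exact: big_split. Qed.

Lemma lsumB C H F : lsum C (fun a u c v => H a u c v - F a u c v) = lsum C H - lsum C F.
Proof. exact: sumrB. Qed.

Lemma lsumZ C k H : lsum C (fun a u c v => k * H a u c v) = k * lsum C H.
Proof. by rewrite /lsum mulr_sumr. Qed.

Lemma lsum_diag H : lsum (fun q => q.1.1 == q.2.1) H =
  \sum_(p <- factor_pairs n) \sum_(1 <= c < p.2)
     H p.1%:Z p.1%:Z c%:Z (p.2%:Z - c%:Z).
Proof.
rewrite -(@big_allpairs_dep _ _ _ _ _ _ (fun (p : nat * nat) (c : nat) => (p, c)) (factor_pairs n)
  (fun p => index_iota 1 p.2)
  (fun x => H x.1.1%:Z x.1.1%:Z x.2%:Z (x.1.2%:Z - x.2%:Z))).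
apply: (@big_seq_bij _ _ _ _ _ _ _
  (fun q => ((q.1.1, q.2.2 + q.1.2)%N, q.2.2))
  (fun x => ((x.1.1, x.1.2 - x.2)%N, (x.1.1, x.2)))).
- exact: liouville_uniq.
- apply: allpairs_uniq_dep; first exact: factor_pairs_uniq.
    by move=> ? _; exact: iota_uniq.
  by move=> -[? ?] [? ?] _ _ /= [-> ->].
- move=> [[a v] [u c]]; rewrite mem_liouville /= => /and5P[a0 v0 u0 c0 /eqP e] /eqP au.
  subst u; split=> //.
  + apply/allpairsPdep; exists (a, c + v)%N, c; split => //; last first.
      by rewrite mem_index_iota /=; lia.
    by rewrite mem_factor_pairs /= a0 addn_gt0 c0 /= -e; apply/eqP; lia.
  + by congr (_, _, (_, _)); lia.
  + by congr H; lia.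
- move=> [[a m] c] /allpairsPdep[[a' m'] [c' [+ + [-> -> ->]]]] _ /=.
  rewrite mem_factor_pairs mem_index_iota /= => /and3P[a0 m0 /eqP e] /andP[c0 cm].
  split => //; first by rewrite mem_liouville /= a0 c0; apply/and3P; split; try apply/eqP; nia.
  by congr (_, _, _); lia.
Qed.

Lemma lsum_codiag H : lsum (fun q => q.1.2 == q.2.2) H =
  \sum_(p <- factor_pairs n) \sum_(1 <= i < p.1)
     H i%:Z (p.1%:Z - i%:Z) p.2%:Z p.2%:Z.
Proof.
rewrite -(@big_allpairs_dep _ _ _ _ _ _ (fun (p : nat * nat) (c : nat) => (p, c)) (factor_pairs n)
  (fun p => index_iota 1 p.1)
  (fun x => H x.2%:Z (x.1.1%:Z - x.2%:Z) x.1.2%:Z x.1.2%:Z)).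
apply: (@big_seq_bij _ _ _ _ _ _ _
  (fun q => ((q.1.1 + q.2.1, q.1.2)%N, q.1.1))
  (fun x => ((x.2, x.1.2), (x.1.1 - x.2, x.1.2))%N)).
- exact: liouville_uniq.
- apply: allpairs_uniq_dep; first exact: factor_pairs_uniq.
    by move=> ? _; exact: iota_uniq.
  by move=> -[? ?] [? ?] _ _ /= [-> ->].
- move=> [[a v] [u c]]; rewrite mem_liouville /= => /and5P[a0 v0 u0 c0 /eqP e] /eqP au.
  subst c; split=> //.
  + apply/allpairsPdep; exists (a + u, v)%N, a; split => //; last first.
      by rewrite mem_index_iota /=; lia.
    by rewrite mem_factor_pairs /= v0 addn_gt0 a0 /= -e; apply/eqP; lia.
  + by congr (_, _, (_, _)); lia.
  + by congr H; lia.
- move=> [[m v] a] /allpairsPdep[[m' v'] [a' [+ + [-> -> ->]]]] _ /=.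
  rewrite mem_factor_pairs mem_index_iota /= => /and3P[m0 v0 /eqP e] /andP[a0 am].
  split => //; first by rewrite mem_liouville /= a0 v0; apply/and3P; split; try apply/eqP; nia.
  by congr (_, _, _); lia.
Qed.

(** This evaluates the full sum of a coboundary by divisors of n: on a = u the equation reads a (c +
    v) = n, on c = v it reads (a + u) v = n. *)
Lemma lsum_shear_solve F H : swap_sym F -> swap_sym H ->
  (forall a u c v, F a u c v = H a u c v - shear H a u c v) ->
  lsum predT F =
  \sum_(p <- factor_pairs n)
    (\sum_(1 <= c < p.2)
       (F p.1%:Z p.1%:Z c%:Z (p.2%:Z - c%:Z) - H p.1%:Z p.1%:Z c%:Z (p.2%:Z - c%:Z))
     + \sum_(1 <= i < p.1) H i%:Z (p.1%:Z - i%:Z) p.2%:Z p.2%:Z).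
Proof.
move=> sF sH FH; have := liouville_identity sH.
rewrite -lsumB -(lsum_eq _ FH) lsum_gt2// => /eqP; rewrite subr_eq => /eqP ->.
rewrite lsum_codiag big_split/=.
under [in RHS]eq_bigr do rewrite sumrB.
by rewrite sumrB !lsum_diag; ring.
Qed.

End LiouvilleIdentity.

Definition divsum k n : int := \sum_(p <- factor_pairs n) p.1%:Z ^+ k.

Lemma factor_pairs0 : factor_pairs 0 = [::].
Proof. by rewrite /factor_pairs; elim: (pairs 0). Qed.

Lemma divsum0 k : divsum k 0 = 0.
Proof. by rewrite /divsum factor_pairs0 big_nil. Qed.

Lemma divsum_mul k n (F : int -> int -> int) (s : int) :
  (forall a b, a * b = n%:Z -> F a b = s * a ^+ k) ->
  \sum_(p <- factor_pairs n) F p.1%:Z p.2%:Z = s * divsum k n.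
Proof.
move=> Fs; rewrite /divsum mulr_sumr; apply: eq_big_seq => -[a b].
by rewrite mem_factor_pairs /= => /and3P[_ _ /eqP e]; apply: Fs; rewrite -PoszM e.
Qed.

Lemma lsum_convolution n (f g : int -> int -> int) :
  lsum n predT (fun a u c v => f a v * g u c) =
  \sum_(j < n.+1) (\sum_(p <- factor_pairs j) f p.1%:Z p.2%:Z) *
                  (\sum_(p <- factor_pairs (n - j)) g p.1%:Z p.2%:Z).
Proof.
rewrite -(big_mkord xpredT (fun j => (\sum_(p <- factor_pairs j) f p.1%:Z p.2%:Z) *
                  (\sum_(p <- factor_pairs (n - j)) g p.1%:Z p.2%:Z))).
under eq_bigr do rewrite big_distrlr /=.
under eq_bigr => j _ do rewrite -(@big_allpairs_dep _ _ _ _ _ _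
  (fun x y : nat * nat => (x, y)) (factor_pairs j) (fun=> factor_pairs (n - j))
  (fun xy => f xy.1.1%:Z xy.1.2%:Z * g xy.2.1%:Z xy.2.2%:Z)).
rewrite -(@big_allpairs_dep _ _ _ _ _ _ (fun (j : nat) (xy : (nat * nat) * (nat * nat)) => (j, xy))
  (index_iota 0 n.+1) (fun j => [seq (x, y) | x <- factor_pairs j, y <- factor_pairs (n - j)])
  (fun jxy => f jxy.2.1.1%:Z jxy.2.1.2%:Z * g jxy.2.2.1%:Z jxy.2.2.2%:Z)).
apply: (@big_seq_bij _ _ _ _ _ _ _ (fun q => (q.1.1 * q.1.2, q)%N) (fun x => x.2)).
- exact: liouville_uniq.
- apply: allpairs_uniq_dep; first exact: iota_uniq.
    move=> j _; apply: allpairs_uniq; rewrite ?factor_pairs_uniq//.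
    by move=> -[? ?] [? ?].
  by move=> -[? ?] [? ?] _ _ /= [-> ->].
- move=> [[a v] [u c]]; rewrite mem_liouville => /and5P[a0 v0 u0 c0 /eqP e] _.
  rewrite /= in a0 v0 u0 c0 e; split; [|by []..].
  apply/allpairsPdep; exists (a * v)%N, ((a, v), (u, c)); split; [by rewrite mem_index_iota; lia| |by []].
  apply/allpairsP; exists ((a, v), (u, c)); rewrite !mem_factor_pairs /= a0 v0 u0 c0 eqxx.
  by split=> //; apply/eqP; lia.
- move=> [j [[a v] [u c]]] /allpairsPdep[j' [xy [+ + [-> exy]]]] _.
  rewrite mem_index_iota -exy => jn /allpairsP[[x y] [+ + [ex ey]]].
  rewrite /= -ex -ey !mem_factor_pairs /= mem_liouville /=.
  move=> /and3P[a0 v0 /eqP e] /and3P[u0 c0 /eqP e'].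
  by split; [apply/and5P; split => //; apply/eqP; lia|by []|congr (_, _)].
Qed.

Definition divconv k l n : int := \sum_(j < n.+1) divsum k j * divsum l (n - j).

Lemma lsum_divconv k l n : lsum n predT (fun a u c v => a ^+ k * u ^+ l) = divconv k l n.
Proof. exact: (lsum_convolution n (fun a _ => a ^+ k) (fun a _ => a ^+ l)). Qed.

Lemma divconvC k l n : divconv k l n = divconv l k n.
Proof.
rewrite /divconv (reindex_inj rev_ord_inj) /=; apply: eq_bigr => i _.
have i_n : (i <= n)%N by rewrite -ltnS.
by rewrite subSS (subKn i_n) mulrC.
Qed.

(** [G] is K times the Faulhaber antidifference of [h], normalised at 1; the factor [K] clears the
    denominators so that all computations stay in [int]. *)
Lemma sum_telescope (K : int) (h G : int -> int) m : G 1 = 0 ->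
  (forall i, G (i + 1) - G i = K * h i) -> (0 < m)%N ->
  K * (\sum_(1 <= i < m) h i%:Z) = G m%:Z.
Proof.
move=> G1 Gh; elim: m => // -[|m] IH _; first by rewrite big_geq // mulr0 G1.
rewrite big_nat_recr //= mulrDr IH // -Gh addrC.
by rewrite [X in G X - _](_ : _ = m.+2%:Z) ?subrK //; lia.
Qed.

Lemma sum_const_nat m (x : int) : (0 < m)%N -> \sum_(1 <= i < m) x = (m%:Z - 1) * x.
Proof. by case: m => // m _; rewrite sumr_const_nat -mulr_natl; congr (_ * _); lia. Qed.

(** The form a^2 + a u + u^2 changes by 2 a u under the shear. The next two evaluations use forms of
    degree 4 and 6 in the same way. *)
Lemma divconv11 n :
  12 * divconv 1 1 n = 5 * divsum 3 n + divsum 1 n - 6 * n%:Z * divsum 1 n.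
Proof.
pose F (a u c v : int) := 2 * (a ^+ 1 * u ^+ 1); pose H (a u c v : int) := a ^+ 2 + a * u + u ^+ 2.
have -> : 12 * divconv 1 1 n = 6 * lsum n predT F.
  by rewrite lsumZ lsum_divconv; ring.
rewrite (@lsum_shear_solve n F H); [|by move=> *; rewrite /F; ring|by move=> *; rewrite /H; ring|
  by move=> *; rewrite /F/H/shear; ring].
rewrite mulr_sumr.
transitivity (\sum_(p <- factor_pairs n) (5 * p.1%:Z ^+ 3 + p.1%:Z - 6 * n%:Z * p.1%:Z)); last first.
  rewrite /divsum sumrB big_split/= -!mulr_sumr; congr (_ + _ - _).
apply: eq_big_seq => -[a m]; rewrite mem_factor_pairs /= => /and3P[a0 m0 /eqP <-].
rewrite /F /H sum_const_nat // mulrDr.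
pose G x (m : int) : int := 6 * x ^+ 2 * m + (-6) * x ^+ 2 + (-3) * x * m ^+ 2 + 3 * x * m + 2 * m ^+ 3 + (-3) * m ^+ 2 + m.
rewrite (@sum_telescope 6 (fun i => i ^+ 2 + i * (a%:Z - i) + (a%:Z - i) ^+ 2) (G a)) //;
  [|by rewrite /G; ring|by move=> *; rewrite /G; ring].
by rewrite /G PoszM; ring.
Qed.

Lemma divconv13 n : 240 * divconv 1 3 n =
  10 * divsum 3 n - divsum 1 n + 21 * divsum 5 n - 30 * n%:Z * divsum 3 n.
Proof.
pose F (a u c v : int) := 4 * (a ^+ 3 * u ^+ 1 + a ^+ 1 * u ^+ 3).
pose H (a u c v : int) := (a ^+ 4 + u ^+ 4) + 2 * (a ^+ 3 * u + a * u ^+ 3) + 3 * a ^+ 2 * u ^+ 2.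
have -> : 240 * divconv 1 3 n = 30 * lsum n predT F.
  by rewrite lsumZ lsumD !lsum_divconv (divconvC 3); ring.
rewrite (@lsum_shear_solve n F H); [|by move=> *; rewrite /F; ring|by move=> *; rewrite /H; ring|
  by move=> *; rewrite /F/H/shear; ring].
rewrite mulr_sumr.
transitivity (\sum_(p <- factor_pairs n)
  (10 * p.1%:Z ^+ 3 - p.1%:Z + 21 * p.1%:Z ^+ 5 - 30 * n%:Z * p.1%:Z ^+ 3)); last first.
  rewrite /divsum sumrB big_split/= sumrB -!mulr_sumr; congr (_ - _ + _ - _).
apply: eq_big_seq => -[a m]; rewrite mem_factor_pairs /= => /and3P[a0 m0 /eqP <-].
rewrite /F /H sum_const_nat // mulrDr.
pose G x (m : int) : int := (30) * x ^+ 4 * m + (-30) * x ^+ 4 + (-30) * x ^+ 3 * m ^+ 2 + (30) * x ^+ 3 * m + (30) * x ^+ 2 * m ^+ 3 + (-45) * x ^+ 2 * m ^+ 2 + (15) * x ^+ 2 * m + (-15) * x * m ^+ 4 + (30) * x * m ^+ 3 + (-15) * x * m ^+ 2 + (6) * m ^+ 5 + (-15) * m ^+ 4 + (10) * m ^+ 3 + (-1) * m.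
rewrite (@sum_telescope 30 (fun i => (i ^+ 4 + (a%:Z - i) ^+ 4) +
  2 * (i ^+ 3 * (a%:Z - i) + i * (a%:Z - i) ^+ 3) + 3 * i ^+ 2 * (a%:Z - i) ^+ 2) (G a)) //;
  [|by rewrite /G; ring|by move=> *; rewrite /G; ring].
by rewrite /G PoszM; ring.
Qed.

(** The combination is that of P R - Q^2, where 24 * 504 and 240^2 = 24 * 2400 are the coefficients.
    Each convolution alone would involve the seventh powers of the divisors, which cancel here. *)
Lemma divconv15_33 n : 504 * divconv 1 5 n - 2400 * divconv 3 3 n =
  21 * divsum 5 n + divsum 1 n + 20 * divsum 3 n - 42 * n%:Z * divsum 5 n.
Proof.
pose F (a u c v : int) := 504 * (a ^+ 5 * u ^+ 1 + a ^+ 1 * u ^+ 5) - 4800 * (a ^+ 3 * u ^+ 3).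
pose H (a u c v : int) := 84 * (a ^+ 6 + u ^+ 6) + 252 * (a ^+ 5 * u + a * u ^+ 5)
  - 990 * (a ^+ 4 * u ^+ 2 + a ^+ 2 * u ^+ 4) - 2400 * (a ^+ 3 * u ^+ 3).
apply: (@mulfI _ 2) => //.
have -> : 2 * (504 * divconv 1 5 n - 2400 * divconv 3 3 n) = lsum n predT F.
  by rewrite lsumB !lsumZ lsumD !lsum_divconv (divconvC 5); ring.
rewrite (@lsum_shear_solve n F H); [|by move=> *; rewrite /F; ring|by move=> *; rewrite /H; ring|
  by move=> *; rewrite /F/H/shear; ring].
transitivity (\sum_(p <- factor_pairs n)
  (42 * p.1%:Z ^+ 5 + 2 * p.1%:Z + 40 * p.1%:Z ^+ 3 - 84 * n%:Z * p.1%:Z ^+ 5)); last first.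
  by rewrite /divsum sumrB !big_split/= -!mulr_sumr; ring.
apply: eq_big_seq => -[a m]; rewrite mem_factor_pairs /= => /and3P[a0 m0 /eqP <-].
rewrite /F /H sum_const_nat //.
pose G x (m : int) : int := (84) * x ^+ 6 * m + (-84) * x ^+ 6 + (-126) * x ^+ 5 * m ^+ 2 + (126) * x ^+ 5 * m + (-330) * x ^+ 4 * m ^+ 3 + (495) * x ^+ 4 * m ^+ 2 + (-165) * x ^+ 4 * m + (600) * x ^+ 3 * m ^+ 4 + (-1200) * x ^+ 3 * m ^+ 3 + (600) * x ^+ 3 * m ^+ 2 + (-198) * x ^+ 2 * m ^+ 5 + (495) * x ^+ 2 * m ^+ 4 + (-330) * x ^+ 2 * m ^+ 3 + (33) * x ^+ 2 * m + (-42) * x * m ^+ 6 + (126) * x * m ^+ 5 + (-105) * x * m ^+ 4 + (21) * x * m ^+ 2 + (12) * m ^+ 7 + (-42) * m ^+ 6 + (42) * m ^+ 5 + (-14) * m ^+ 3 + (2) * m.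
rewrite -[X in _ + X = _]mul1r (@sum_telescope 1 (fun i => 84 * (i ^+ 6 + (a%:Z - i) ^+ 6) +
  252 * (i ^+ 5 * (a%:Z - i) + i * (a%:Z - i) ^+ 5)
  - 990 * (i ^+ 4 * (a%:Z - i) ^+ 2 + i ^+ 2 * (a%:Z - i) ^+ 4)
  - 2400 * (i ^+ 3 * (a%:Z - i) ^+ 3)) (G a)) //;
  [|by rewrite /G; ring|by move=> *; rewrite /G; ring].
by rewrite /G PoszM; ring.
Qed.

(** * The differential equation of the discriminant *)

Lemma tau1 : tau 1 = 1.
Proof.
by rewrite /tau /delta_trunc big_nat1 coefXM /= -horner_coef0 horner_exp !hornerE expr1n.
Qed.

Section TruncatedSeries.
Variable N : nat.
Implicit Types p q : {poly int}.

(** Congruence modulo X^N, which lets polynomials stand for power series. *)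
Definition eqX p q := exists r, p = q + r * 'X^N.

Lemma eqXP p q : (forall i, (i < N)%N -> p`_i = q`_i) -> eqX p q.
Proof.
move=> pq; exists (drop_poly N (p - q)).
rewrite -[LHS](subrK q) addrC -{1}[p - q](poly_take_drop N) addrA; congr (_ + _).
rewrite [X in _ + X](_ : _ = 0) ?addr0 //; apply/polyP => i.
rewrite coef_take_poly coef0; case: ifP => // iN.
by rewrite coefB pq // subrr.
Qed.

Lemma eqX_coef p q i : eqX p q -> (i < N)%N -> p`_i = q`_i.
Proof. by move=> [r ->] iN; rewrite coefD coefMXn iN addr0. Qed.

Definition theta p := 'X * p^`().

Lemma coef_theta p i : (theta p)`_i = i%:Z * p`_i.
Proof.
rewrite /theta mulrC coefMX; case: i => [|i] /=; first by rewrite mul0r.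
by rewrite coef_deriv -mulr_natl natz.
Qed.

Lemma thetaD p q : theta (p + q) = theta p + theta q.
Proof. by rewrite /theta derivD mulrDr. Qed.

Lemma thetaB p q : theta (p - q) = theta p - theta q.
Proof. by rewrite /theta derivB mulrBr. Qed.

Lemma thetaM p q : theta (p * q) = theta p * q + p * theta q.
Proof. by rewrite /theta derivM; ring. Qed.

Definition sigma_poly k : {poly int} := \poly_(i < N) divsum k i.

Lemma coef_sigma_poly k i : (i < N)%N -> (sigma_poly k)`_i = divsum k i.
Proof. by move=> iN; rewrite coef_poly iN. Qed.

Lemma coef_sigma_polyM k l i : (i < N)%N ->
  (sigma_poly k * sigma_poly l)`_i = divconv k l i.
Proof.
move=> iN; rewrite coefM; apply: eq_bigr => j _.
by rewrite !coef_sigma_poly //; [exact: leq_ltn_trans (leq_subr _ _) iN|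
   exact: leq_trans (ltn_ord j) iN].
Qed.

(** Ramanujan's P, Q, R, that is the Eisenstein series of weight 2, 4 and 6 truncated at X^N. *)
Let P := 1 - 24%:R * sigma_poly 1.
Let Q := 1 + 240%:R * sigma_poly 3.
Let R := 1 - 504%:R * sigma_poly 5.

Lemma coef_natM n p i : (n%:R * p)`_i = n%:R * p`_i.
Proof. by rewrite mulr_natl coefMn mulr_natl. Qed.

Lemma theta1 : theta 1 = 0.
Proof. by rewrite /theta derivC mulr0. Qed.

Lemma thetanM n p : theta (n%:R * p) = n%:R * theta p.
Proof. by rewrite /theta mulr_natl derivMn; ring. Qed.

(* Ramanujan's equations 3 X Q' = P Q - R and 2 X R' = P R - Q^2. *)
Lemma ramanujan_Q : eqX (3%:R * theta Q) (P * Q - R).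
Proof.
apply: eqXP => i iN; rewrite /P /Q /R.
rewrite thetaD theta1 add0r thetanM.
have -> : (1 - 24%:R * sigma_poly 1) * (1 + 240%:R * sigma_poly 3)
   - (1 - 504%:R * sigma_poly 5) =
  240%:R * sigma_poly 3 - 24%:R * sigma_poly 1 + 504%:R * sigma_poly 5
  - 24%:R * (240%:R * (sigma_poly 1 * sigma_poly 3)) by ring.
rewrite !(coefD, coefN, coef_natM) coef_theta coef_sigma_polyM // !coef_sigma_poly //.
have := divconv13 i; rewrite -[240 * divconv _ _ _]/(240%:R * divconv 1 3 i) => ->.
ring.
Qed.

Lemma ramanujan_R : eqX (2%:R * theta R) (P * R - Q * Q).
Proof.
apply: eqXP => i iN; rewrite /P /Q /R.
rewrite thetaB theta1 sub0r thetanM.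
have -> : (1 - 24%:R * sigma_poly 1) * (1 - 504%:R * sigma_poly 5)
   - (1 + 240%:R * sigma_poly 3) * (1 + 240%:R * sigma_poly 3) =
  24%:R * (504%:R * (sigma_poly 1 * sigma_poly 5) - (24%:R * 100%:R) * (sigma_poly 3 * sigma_poly 3))
  - 504%:R * sigma_poly 5 - 24%:R * sigma_poly 1 - 480%:R * sigma_poly 3 by ring.
rewrite -natrM !(coefD, coefN, coef_natM) coef_theta !coef_sigma_polyM // !coef_sigma_poly //.
have := divconv15_33 i.
rewrite -[504 * divconv _ _ _]/(504%:R * divconv 1 5 i).
rewrite -[2400 * divconv _ _ _]/((24 * 100)%:R * divconv 3 3 i) => ->.
ring.
Qed.

Let f := Q * Q * Q - R * R.

(** In Q^2 (P Q - R) - R (P R - Q^2) the mixed terms Q^2 R cancel. *)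
Lemma cusp_ode : eqX (theta f) (P * f).
Proof.
have [r rE] := ramanujan_Q; have [s sE] := ramanujan_R.
exists (r * Q * Q - s * R).
have -> : theta f = (3%:R * theta Q) * Q * Q - (2%:R * theta R) * R.
  by rewrite /f thetaB !thetaM; ring.
by rewrite rE sE /f; ring.
Qed.

(** In R (P Q - R) - Q (P R - Q^2) the series P cancels; this is the Rankin-Cohen bracket of Q and
    R. *)
Lemma cusp_bracket : eqX f (3%:R * (R * theta Q) - 2%:R * (Q * theta R)).
Proof.
have [r rE] := ramanujan_Q; have [s sE] := ramanujan_R.
exists (s * Q - r * R).
have -> : 3%:R * (R * theta Q) - 2%:R * (Q * theta R) =
   R * (3%:R * theta Q) - Q * (2%:R * theta R) by ring.
by rewrite rE sE /f; ring.
Qed.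

(** The coefficient of X^i gives i - 1 times p_i as a combination of lower coefficients, so only the
    one at i = 1 is free. *)
Lemma ode_unique p : eqX (theta p) (P * p) -> p`_1 = 0 ->
  forall i, (i < N)%N -> p`_i = 0.
Proof.
move=> pE p1; elim/ltn_ind => i IH iN.
have := eqX_coef pE iN; rewrite coef_theta /P mulrBl mul1r coefB -mulrA coef_natM coefM.
rewrite big_ord_recl /= coef_sigma_poly ?(leq_ltn_trans _ iN)// divsum0 mul0r add0r.
rewrite big1 => [|j _]; last first.
  have ji : (i - bump 0 j < i)%N by rewrite /bump /=; have := ltn_ord j; lia.
  by rewrite IH ?mulr0 // (ltn_trans ji).
rewrite mulr0 subr0 => /eqP; rewrite -subr_eq0 -[X in _ - X]mul1r -mulrBl mulf_eq0.
case/orP => [|/eqP //]; rewrite subr_eq0 => /eqP [i1].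
by rewrite i1 p1.
Qed.

(** The truncated series k X^k / (1 - X^k), minus the logarithmic derivative of 1 - X^k under
    [theta]. *)
Let geo k := k%:R * \sum_(1 <= j < N.+1) 'X^(k * j) : {poly int}.

Lemma geoE k : (0 < k)%N -> eqX ((1 - 'X^k) * geo k) (k%:R * 'X^k).
Proof.
move=> k0; exists (- (k%:R * 'X^(k * N + k - N))).
rewrite mulNr -[_ * 'X^N]mulrA -exprD subnK; last by nia.
rewrite /geo mulrCA mulrA -mulrBr -mulrA; congr (_ * _).
elim: (N) => [|n IH]; first by rewrite big_geq // muln0 mulr0 subrr.
rewrite big_nat_recr //= mulrDr IH (_ : k * n + k = k * n.+1)%N; last by rewrite mulnS addnC.
by rewrite exprD; ring.
Qed.

Lemma eqX_trans p q r : eqX p q -> eqX q r -> eqX p r.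
Proof. by move=> [s ->] [t ->]; exists (t + s); rewrite mulrDl addrA. Qed.

(** Logarithmic differentiation of the product, written without division. The number M of factors is
    independent of the precision N, which permits induction on M. *)
Lemma delta_trunc_ode M :
  eqX (theta (delta_trunc int M)) ((1 - 24%:R * \sum_(1 <= k < M.+1) geo k) * delta_trunc int M).
Proof.
elim: M => [|M [r rE]].
  exists 0; rewrite /delta_trunc !big_geq // mulr0 subr0 !mulr1 mul0r addr0 mul1r.
  by rewrite /theta derivX mulr1.
rewrite /delta_trunc; set d := delta_trunc int M in rE.
rewrite [\prod_(_ <= _ < _) _]big_nat_recr //= mulrA -/(delta_trunc int M) -/d.
rewrite [\sum_(_ <= _ < _) _]big_nat_recr //=.
have [s sE] := geoE (ltn0Sn M); set e := 1 - 'X^(M.+1) in sE *.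
have eE : theta (e ^+ 24) = - 24%:R * e ^+ 23 * (M.+1%:R * 'X^(M.+1)).
  rewrite /theta deriv_exp /e derivB derivC derivXn -mulr_natl /= -mulr_natl.
  by rewrite [X in _ = _ * (_ * X)]exprS; ring.
exists (r * e ^+ 24 + 24%:R * d * e ^+ 23 * s).
rewrite thetaM rE eE.
have -> : M.+1%:R * 'X^(M.+1) = e * geo M.+1 - s * 'X^N by rewrite sE addrK.
by rewrite (exprS e 23); ring.
Qed.

(** A Lambert series: the term k X^(k j) contributes the divisor k to the coefficient of X^(k j). *)
Lemma sum_geo M : (N <= M)%N -> eqX (\sum_(1 <= k < M.+1) geo k) (sigma_poly 1).
Proof.
move=> NM; apply: eqXP => i iN; rewrite coef_sigma_poly // coef_sum.
under eq_bigr do rewrite coef_natM coef_sum mulr_sumr.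
rewrite -(@big_allpairs_dep _ _ _ _ _ _ (fun k j : nat => (k, j)) (index_iota 1 M.+1)
  (fun=> index_iota 1 N.+1)
  (fun p : nat * nat => p.1%:R * (('X^(p.1 * p.2))%R : {poly int})`_i)) /divsum.
under eq_bigr do rewrite coefXn mulr_natr mulrb.
rewrite -big_mkcond; apply: (@big_seq_bij _ _ _ _ _ _ _ id id).
- by apply: allpairs_uniq; rewrite ?iota_uniq // => -[? ?] [? ?].
- exact: factor_pairs_uniq.
- move=> [k j] /allpairsP[[k' j'] [+ + [-> ->]]].
  rewrite !mem_index_iota => /andP[k0 _] /andP[j0 _] /eqP e.
  by split=> //; rewrite ?mem_factor_pairs ?natz //; apply/and3P; split=> //; apply/eqP.
- move=> [k j]; rewrite mem_factor_pairs => /and3P[k0 j0 /eqP e] _.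
  rewrite /= in k0 j0 e.
  split=> //; last exact/eqP.
  by apply/allpairsP; exists (k, j); rewrite !mem_index_iota; split=> //=; nia.
Qed.

Lemma delta_ode M : (N <= M)%N -> eqX (theta (delta_trunc int M)) (P * delta_trunc int M).
Proof.
move=> NM; have [r rE] := sum_geo NM; apply: eqX_trans (delta_trunc_ode M) _.
by rewrite rE; exists (- 24%:R * r * delta_trunc int M); rewrite /P; ring.
Qed.

(** The coefficient of X^n in 2 S_3 theta(S_5) - 3 S_5 theta(S_3) with S_k = [sigma_poly k]: here
    u^6 c is u^5 times the index u c, and a^4 v is a^3 times the index a v. *)
Definition tau_conv n : int :=
  lsum n predT (fun a u c v => 2%:R * (a ^+ 3 * (u ^+ 6 * c)) - 3%:R * (u ^+ 5 * (a ^+ 4 * v))).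

Lemma coef_sigma_poly_theta k l n : (n < N)%N ->
  (sigma_poly k * theta (sigma_poly l))`_n =
  lsum n predT (fun a u c v => a ^+ k * (u ^+ l.+1 * c)).
Proof.
move=> nN; rewrite (lsum_convolution n (fun a _ => a ^+ k) (fun u c => u ^+ l.+1 * c)) coefM.
apply: eq_bigr => j _; have jn : (j <= n)%N by rewrite -ltnS.
have jN : (j < N)%N := leq_ltn_trans jn nN.
have njN : (n - j < N)%N := leq_ltn_trans (leq_subr _ _) nN.
rewrite coef_theta !coef_sigma_poly // -[RHS]/(divsum k j * _); congr (_ * _).
rewrite (@divsum_mul l (n - j) (fun u c => u ^+ l.+1 * c) (n - j)%:Z) //.
by move=> u c <-; rewrite exprS; ring.
Qed.

Lemma cusp_coef n : (n < N)%N ->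
  f`_n = 144%:R * (n%:Z * (5%:R * divsum 3 n + 7%:R * divsum 5 n) + 840%:R * tau_conv n).
Proof.
move=> nN; rewrite (eqX_coef cusp_bracket nN).
have -> : 3%:R * (R * theta Q) - 2%:R * (Q * theta R) =
  144%:R * (5%:R * theta (sigma_poly 3) + 7%:R * theta (sigma_poly 5) +
  840%:R * (2%:R * (sigma_poly 3 * theta (sigma_poly 5)) -
            3%:R * (sigma_poly 5 * theta (sigma_poly 3)))).
  by rewrite /Q /R thetaD thetaB theta1 !thetanM; ring.
rewrite coef_natM; congr (_ * _); rewrite !(coefD, coefN, coef_natM).
rewrite !coef_sigma_poly_theta // !coef_theta !coef_sigma_poly //; congr (_ + 840%:R * _).
  by ring.
rewrite /tau_conv lsumB !lsumZ; congr (_ - 3%:R * _).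
exact: (@lsum_swap n predT predT).
Qed.

(** Both sides solve the same first order equation, and at X the bracket gives 144 (5 + 7). *)
Lemma cusp_tau n : (1 < N)%N -> (n < N)%N -> f`_n = (144 * 12)%:R * tau n.
Proof.
move=> N1 nN; rewrite -[tau n]intz -(delta_trunc_tau _ (ltnW nN)) -coef_natM.
apply/eqP; rewrite -subr_eq0 -coefB.
apply/eqP; apply: ode_unique => //.
  have [r rE] := delta_ode (leqnn N); have [s sE] := cusp_ode.
  exists (s - (144 * 12)%:R * r); rewrite thetaB thetanM rE sE; ring.
rewrite coefB coef_natM (delta_trunc_tau _ (ltnW N1)) cusp_coef //.
have d1 k : divsum k 1 = 1.
  by rewrite /divsum (_ : factor_pairs 1 = [:: (1, 1)%N]) // big_seq1 expr1n.
have -> : tau_conv 1 = 0.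
  by rewrite /tau_conv /lsum (_ : liouville 1 = [::]) // big_nil.
by rewrite tau1 !d1 intz; ring.
Qed.

End TruncatedSeries.

Lemma tau_formula n :
  12%:R * tau n = n%:Z * (5%:R * divsum 3 n + 7%:R * divsum 5 n) + 840%:R * tau_conv n.
Proof.
apply: (@mulfI _ 144%:R) => //.
rewrite -(@cusp_coef n.+2) // mulrA -natrM -(@cusp_tau n.+2) //.
Qed.

(** * The modular symbol of weight 12 *)

(* The odd period polynomial 4 X^9 Y - 25 X^7 Y^3 + 42 X^5 Y^5 - 25 X^3 Y^7
   + 4 X Y^9 of the weight 12 cusp form. *)
Definition per (X Y : int) : int :=
  X * Y * (X ^+ 2 - Y ^+ 2) ^+ 2 * (X ^+ 2 - 4%:R * Y ^+ 2) * (4%:R * X ^+ 2 - Y ^+ 2).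

(** Subtractive Euclidean algorithm with fuel [k]. The first shear fixes 1 / 0, where the symbol
    vanishes, and needs no correction; the second moves 1 / 0 to 1 / 1 and is corrected by the value
    there, [per X Y - per (X + Y) Y]. *)
Fixpoint euclid_symbol k (x y : nat) (X Y : int) : int :=
  if k is k'.+1 then
    if y == 0%N then 0 else if x == 0%N then per X Y
    else if (y <= x)%N then euclid_symbol k' (x - y) y X (X + Y)
    else euclid_symbol k' x (y - x) (X + Y) Y + per X Y - per (X + Y) Y
  else 0.

Definition nsym x y := euclid_symbol (x + y) x y.

Lemma euclid_symbol_fuel k x y X Y : (x + y <= k)%N ->
  euclid_symbol k x y X Y = nsym x y X Y.
Proof.
move=> le_k; suff gen l : (x + y <= l)%N -> euclid_symbol k x y X Y = euclid_symbol l x y X Y.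
  exact: gen.
elim: k l x y X Y le_k => [|k IH] [|l] x y X Y //.
- by rewrite leqn0 addn_eq0 => /andP[/eqP-> /eqP->].
- by rewrite leqn0 addn_eq0 => _ /andP[/eqP-> /eqP->].
move=> le_k le_l /=; case: eqP => // y0; case: eqP => // x0.
by case: leqP => xy; rewrite (IH l) //; lia.
Qed.

Lemma nsym_rec x y X Y : (0 < x)%N -> (0 < y)%N ->
  nsym x y X Y = if (y <= x)%N then nsym (x - y) y X (X + Y)
                 else nsym x (y - x) (X + Y) Y + per X Y - per (X + Y) Y.
Proof.
move=> x0 y0; rewrite -(@euclid_symbol_fuel (x + y).+1) // [LHS]/=.
rewrite !eqn0Ngt x0 y0 /=.
by case: leqP => xy; rewrite euclid_symbol_fuel //; lia.
Qed.

Lemma nsym_x0 x X Y : nsym x 0 X Y = 0.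
Proof. by rewrite /nsym; case: (x + 0)%N. Qed.

Lemma nsym_0y y X Y : (0 < y)%N -> nsym 0 y X Y = per X Y.
Proof. by case: y. Qed.

Lemma nsym_shear x y X Y : nsym (x + y) y X Y = nsym x y X (X + Y).
Proof.
case: y => [|y]; first by rewrite addn0 !nsym_x0.
by rewrite nsym_rec ?addnS // -addnS leq_addl addnK.
Qed.

(** The three-term period relation in Lewis's form. It makes the branches of the definition agree
    wherever they meet. *)
Lemma per_lewis X Y : per X Y = per X (X + Y) + per (X + Y) Y.
Proof. by rewrite /per; ring. Qed.

Lemma perN X Y : per (- X) Y = - per X Y.
Proof. by rewrite /per; ring. Qed.

Lemma perC X Y : per Y X = per X Y.
Proof. by rewrite /per; ring. Qed.

Lemma nsym_shear' x y X Y : (0 < x + y)%N ->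
  nsym x (x + y) X Y = nsym x y (X + Y) Y + per X Y - per (X + Y) Y.
Proof.
case: x => [|x] xy; first by rewrite add0n !nsym_0y //; ring.
case: y xy => [|y] _.
  (* At x = y the recursion takes the other branch; the three-term relation reconciles the two. *)
  rewrite addn0 -[in LHS](add0n x.+1) nsym_shear nsym_0y // nsym_x0 (per_lewis X Y).
  by ring.
rewrite nsym_rec ?addSn // addnS ifF; last by lia.
by rewrite -addnS -addSn addKn.
Qed.

Lemma nat_euclid_ind (C : nat -> nat -> Prop) :
  (forall x, C x 0%N) -> (forall y, (0 < y)%N -> C 0%N y) ->
  (forall x y, C x y -> C (x + y)%N y) ->
  (forall x y, (0 < x + y)%N -> C x y -> C x (x + y)%N) ->
  forall x y, C x y.
Proof.
move=> C0 C0' C1 C2 x y; move: {2}(x + y)%N (leqnn (x + y)) => k.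
elim: k x y => [|k IH] [|x] [|y] // le_k.
  exact: C0'.
case: (leqP x y) => xy.
  have -> : y.+1 = (x.+1 + (y - x))%N by lia.
  by apply: C2; [lia|apply: IH; lia].
have -> : x.+1 = (x - y + y.+1)%N by lia.
by apply: C1; apply: IH; lia.
Qed.

Lemma nsymC x y X Y : (0 < x + y)%N -> nsym y x Y X = per X Y - nsym x y X Y.
Proof.
move: x y X Y; apply: nat_euclid_ind => [x|y y0|x y IH|x y xy0 IH] X Y xy.
- by rewrite nsym_x0 nsym_0y; [rewrite perC subr0|lia].
- by rewrite nsym_x0 nsym_0y // subrr.
- case: (posnP (x + y)) => [e|xy0]; first by move: xy; lia.
  rewrite nsym_shear addnC nsym_shear'; last by rewrite addnC.
  by rewrite (addrC Y) IH // (perC X Y) (perC X (X + Y)) (per_lewis X Y); ring.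
- by rewrite nsym_shear' // addnC nsym_shear (addrC Y) IH //; ring.
Qed.

(** The symbol inherits the degree 10 of [per], the weight 12 minus 2. *)
Lemma nsym_hom x y k X Y : nsym x y (k * X) (k * Y) = k ^+ 10 * nsym x y X Y.
Proof.
have perk U V : per (k * U) (k * V) = k ^+ 10 * per U V by rewrite /per; ring.
move: x y X Y; apply: nat_euclid_ind => [x|y y0|x y IH|x y xy0 IH] X Y.
- by rewrite !nsym_x0 mulr0.
- by rewrite !nsym_0y.
- by rewrite !nsym_shear -mulrDr IH.
- by rewrite !nsym_shear' // -mulrDr IH !perk; ring.
Qed.

Lemma nsym_scale m x y X Y : (0 < m)%N -> nsym (m * x) (m * y) X Y = nsym x y X Y.
Proof.
move=> m0; move: x y X Y; apply: nat_euclid_ind => [x|y y0|x y IH|x y xy0 IH] X Y.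
- by rewrite muln0 !nsym_x0.
- by rewrite muln0 !nsym_0y // muln_gt0 m0.
- by rewrite mulnDr !nsym_shear IH.
- by rewrite mulnDr !nsym_shear' ?IH // -mulnDr muln_gt0 m0.
Qed.

(* The branch of negative x / y is forced by [psym_reflect]. *)
Definition psym (x y X Y : int) : int :=
  if 0 <= x * y then nsym `|x|%N `|y|%N X Y else - nsym `|x|%N `|y|%N (- X) Y.

Definition nonzero (x y : int) := (x != 0) || (y != 0).

Lemma psymNN x y X Y : psym (- x) (- y) X Y = psym x y X Y.
Proof. by rewrite /psym mulrNN !abszN. Qed.

Lemma psym_x0 x X Y : psym x 0 X Y = 0.
Proof. by rewrite /psym mulr0 lexx nsym_x0. Qed.

Lemma psym_0y y X Y : y != 0 -> psym 0 y X Y = per X Y.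
Proof. by move=> y0; rewrite /psym mul0r lexx nsym_0y // absz_gt0. Qed.

Lemma psym_reflect x y X Y : psym (- x) y (- X) Y = - psym x y X Y.
Proof.
have [->|y0] := eqVneq y 0; first by rewrite !psym_x0 oppr0.
have [->|x0] := eqVneq x 0; first by rewrite oppr0 !psym_0y // perN.
have := mulf_neq0 x0 y0; rewrite /psym mulNr oppr_ge0 abszN opprK.
by case: ltgtP => // _ _; rewrite opprK.
Qed.

Lemma psym_hom x y k X Y : psym x y (k * X) (k * Y) = k ^+ 10 * psym x y X Y.
Proof. by rewrite /psym -mulrN !nsym_hom; case: ifP => _; rewrite // mulrN. Qed.

Lemma psym_even x y X Y : psym x y (- X) (- Y) = psym x y X Y.
Proof. by rewrite -(mulN1r X) -(mulN1r Y) psym_hom; ring. Qed.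

Lemma psym_scale m x y X Y : m != 0 -> psym (m * x) (m * y) X Y = psym x y X Y.
Proof.
move=> m0; rewrite /psym !abszM !nsym_scale ?absz_gt0 //.
by rewrite mulrACA pmulr_rge0 // lt0r mulf_neq0 //= -expr2 sqr_ge0.
Qed.

Lemma psymC x y X Y : nonzero x y -> psym y x Y X = per X Y - psym x y X Y.
Proof.
move=> xy; have xy' : (0 < `|x| + `|y|)%N by move: xy; rewrite /nonzero; lia.
rewrite /psym mulrC; case: ifP => _; first by rewrite nsymC.
have -> : nsym `|y|%N `|x|%N (- Y) X = nsym `|y|%N `|x|%N Y (- X).
  by rewrite -(mulN1r Y) -[X in nsym _ _ _ X]opprK -(mulN1r (- X)) nsym_hom; ring.
by rewrite nsymC // perN; ring.
Qed.

Lemma psym_nat (x y : nat) X Y : psym x y X Y = nsym x y X Y.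
Proof. by rewrite /psym -PoszM. Qed.

Lemma psym_natN (x y : nat) X Y : psym (- x%:Z) y X Y = - nsym x y (- X) Y.
Proof. by rewrite -[X in psym _ _ X _]opprK psym_reflect psym_nat. Qed.

Lemma psym_shear x y X Y : psym (x + y) y X Y = psym x y X (X + Y).
Proof.
wlog: x y / 0 <= y => [H|].
  have [/H//|/ltW y0] := lerP 0 y.
  by rewrite -psymNN opprD H ?oppr_ge0 // psymNN.
case: y => // y _; have [|] := lerP 0 x; first case: x => // x _.
  by rewrite -PoszD !psym_nat nsym_shear.
case: x => // u _; rewrite NegzE; case: (leqP y u.+1) => yu.
  have [w ->] : exists w, u.+1 = (w + y)%N by exists (u.+1 - y)%N; lia.
  rewrite (_ : - (w + y)%N%:Z + y%:Z = - w%:Z) ?psym_natN ?nsym_shear; last by lia.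
  by congr (- nsym _ _ _ _); ring.
(* The cusp lies in (-1, 0) and is moved to a positive one, so the two branches of [psym] meet; they
   match by the swap and the three-term relation. *)
have [w ->] : exists w, y = (u.+1 + w)%N by exists (y - u.+1)%N; lia.
rewrite (_ : - u.+1%:Z + (u.+1 + w)%N%:Z = w%:Z); last by lia.
rewrite psym_natN psym_nat {1}(addnC u.+1) nsym_shear' ?addnS //.
rewrite nsym_shear' // (_ : - X + (X + Y) = Y); last by ring.
rewrite (nsymC (X + Y) Y) ?addnS // perN.
have := per_lewis X Y; rewrite (perC Y (X + Y)); lra.
Qed.

Lemma psym_shear' x y X Y : nonzero x y ->
  psym x (x + y) X Y = psym x y (X + Y) Y + per X Y - per (X + Y) Y.
Proof.
move=> xy; have xy' : nonzero (x + y) x by move: xy; rewrite /nonzero; lia.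
rewrite (psymC Y X xy') (addrC x) psym_shear (psymC (Y + X) Y) ?(addrC Y) //.
by rewrite (perC X Y); ring.
Qed.

(* psym x y is the value at the cusp x / y of a modular symbol normalised to
   vanish at 1 / 0: up to an additive constant it is equivariant under SL(2, Z),
   and its jump from 1 / 0 to 0 / 1 is [per]. *)
Definition equivariant (a b c d : int) := forall x y X Y, nonzero x y ->
  psym (a * x + b * y) (c * x + d * y) X Y =
  psym x y (a * X + c * Y) (b * X + d * Y) + psym a c X Y.

Lemma nonzero_unimodular a b c d x y : a * d - b * c = 1 -> nonzero x y ->
  nonzero (a * x + b * y) (c * x + d * y).
Proof.
move=> det; rewrite /nonzero -!negb_and; apply: contra => /andP[/eqP e1 /eqP e2].
have ex : x = d * (a * x + b * y) - b * (c * x + d * y) by rewrite -[LHS]mul1r -det; ring.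
have ey : y = a * (c * x + d * y) - c * (a * x + b * y) by rewrite -[LHS]mul1r -det; ring.
by rewrite e1 e2 !mulr0 subrr in ex ey; rewrite ex ey eqxx.
Qed.

Lemma equivariant_comp a b c d a' b' c' d' : a' * d' - b' * c' = 1 ->
  equivariant a b c d -> equivariant a' b' c' d' ->
  equivariant (a * a' + b * c') (a * b' + b * d') (c * a' + d * c') (c * b' + d * d').
Proof.
move=> det e e' x y X Y xy.
have -> : (a * a' + b * c') * x + (a * b' + b * d') * y =
  a * (a' * x + b' * y) + b * (c' * x + d' * y) by ring.
have -> : (c * a' + d * c') * x + (c * b' + d * d') * y =
  c * (a' * x + b' * y) + d * (c' * x + d' * y) by ring.
rewrite e; last exact: nonzero_unimodular.
rewrite e' // -addrA; congr (_ + _).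
  by congr (psym _ _ _ _); ring.
have nz : nonzero a' c' by move: det; rewrite /nonzero; case: eqVneq => //= ->; case: eqVneq => // ->; rewrite mul0r mulr0.
by rewrite e // addrC.
Qed.

Lemma equivariant_congr a b c d a' b' c' d' : equivariant a b c d ->
  a = a' -> b = b' -> c = c' -> d = d' -> equivariant a' b' c' d'.
Proof. by move=> e <- <- <- <-. Qed.

Lemma equivariant_T (q : int) : equivariant 1 q 0 1.
Proof.
have eT : equivariant 1 1 0 1.
  move=> x y X Y _; rewrite psym_x0 addr0 !mul1r !mul0r add0r addr0.
  exact: psym_shear.
have eT' : equivariant 1 (-1) 0 1.
  move=> x y X Y _; rewrite psym_x0 addr0 !mul1r !mul0r add0r addr0 mulN1r.
  by have := psym_shear (x - y) y X (Y - X); rewrite subrK (addrC X) subrK => <-; rewrite mulN1r addrC.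
have eq (m : nat) : equivariant 1 m 0 1 /\ equivariant 1 (- m%:Z) 0 1.
  elim: m => [|m [IH1 IH2]].
    have e0 : equivariant 1 0 0 1.
      by move=> x y X Y _; rewrite psym_x0 !mul1r !mul0r !addr0 !add0r.
    by rewrite oppr0.
  have det (x : int) : 1 * 1 - x * 0 = 1 by ring.
  split.
    by apply: (equivariant_congr (equivariant_comp (det m) eT IH1)); lia.
  by apply: (equivariant_congr (equivariant_comp (det (- m%:Z)) eT' IH2)); lia.
case: q => m; first exact: (eq m).1.
rewrite NegzE; exact: (eq m.+1).2.
Qed.

Lemma equivariant_S : equivariant 0 (-1) 1 0.
Proof.
move=> x y X Y xy; rewrite psym_0y // !mul0r !mul1r !add0r addr0 !mulN1r.
rewrite -[X in psym _ _ X _]opprK psym_reflect.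
have -> : - psym y x (- X) Y = - (per Y (- X) - psym x y Y (- X)) by rewrite -psymC.
by rewrite perC perN addr0; ring.
Qed.

(** Generation of SL(2, Z) by T and S: with a = q c + r the matrix is T^q S times ((c, d), (-r, q d
    - b)), whose lower left entry is smaller than c in absolute value. The base case c = 0 is a
    power of T up to sign. *)
Lemma equivariant_SL2 a b c d : a * d - b * c = 1 -> equivariant a b c d.
Proof.
move: {2}`|c|%N (leqnn `|c|%N) => k; elim: k a b c d => [|k IH] a b c d.
  rewrite leqn0 absz_eq0 => /eqP -> ; rewrite mulr0 subr0 => det.
  have [[-> ->]|[-> ->]] : (a = 1 /\ d = 1) \/ (a = -1 /\ d = -1).
    have : (`|a| * `|d| = 1)%N by rewrite -abszM det.
    move/eqP; rewrite muln_eq1 => /andP[/eqP a1 /eqP d1].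
    have [a_eq|a_eq] : a = 1 \/ a = -1 by lia.
      by left; split; move: det; rewrite a_eq; lia.
    by right; split; move: det; rewrite a_eq; lia.
    exact: equivariant_T.
  move=> x y X Y xy; have := equivariant_T (- b) X Y xy.
  rewrite !psym_x0 !mul1r !mul0r !add0r !addr0 => e.
  rewrite -psymNN -[in RHS]psym_even.
  have -> : - (-1 * x + b * y) = x + - b * y by ring.
  by rewrite mulN1r opprK e; congr (psym _ _ _ _); ring.
have [-> _|c0 ck det] := eqVneq c 0; first by apply: IH.
pose q := (a %/ c)%Z; pose r := (a %% c)%Z.
have aE : a = q * c + r by exact: divz_eq.
have e1 : equivariant c d (- r) (q * d - b).
  apply: IH; first by have := ltz_mod a c0; have := modz_ge0 a c0; rewrite -/r; lia.
  by move: det; rewrite aE; lra.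
have det1 : c * (q * d - b) - d * - r = 1 by move: det; rewrite aE; lra.
have det2 : r * d - (b - q * d) * c = 1 by rewrite -det1; ring.
have e2 : equivariant r (b - q * d) c d.
  by apply: (equivariant_congr (equivariant_comp det1 equivariant_S e1)); ring.
by apply: (equivariant_congr (equivariant_comp det2 (equivariant_T q) e2)); rewrite ?aE; ring.
Qed.

(* Merel's Heilbronn matrices ((a, b), (c, d)) of determinant n: by
   [period_sum_boundary] the corresponding sum of period polynomials is the
   period polynomial of the Hecke operator T_n. *)
Definition merel n : seq ((nat * nat) * (nat * nat)) :=
  [seq h <- [seq (x, y) | x <- pairs n, y <- pairs n] |
    [&& h.1.2 < h.1.1, h.2.1 < h.2.2 & h.1.1 * h.2.2 == n + h.1.2 * h.2.1]%N].

Lemma mem_merel n h : (h \in merel n) =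
  [&& h.1.2 < h.1.1, h.2.1 < h.2.2 & h.1.1 * h.2.2 == n + h.1.2 * h.2.1]%N.
Proof.
rewrite mem_filter andb_idr//; case: h => [[a b] [c d]] /and3P[ba cd /eqP e].
rewrite /= in ba cd e.
by apply/allpairsP; exists ((a, b), (c, d)); rewrite !mem_pairs; split=> //=; nia.
Qed.

Lemma merel_uniq n : uniq (merel n).
Proof.
apply: filter_uniq; apply: allpairs_uniq; rewrite ?pairs_uniq//.
by move=> -[? ?] [? ?].
Qed.

Definition period_sum n (X Y : int) : int := \sum_(h <- merel n)
  per (h.1.1%:Z * X + h.2.1%:Z * Y) (h.1.2%:Z * X + h.2.2%:Z * Y).

(** The cusp d / -c is the image of 1 / 0 under the adjugate of ((a, b), (c, d)). The terms of
    [period_sum] are differences of these values. *)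
Definition base_value (a b c d X Y : int) : int :=
  psym d (- c) (a * X + c * Y) (b * X + d * Y).

Lemma base_value_step (a b c d k X Y : int) : d != 0 ->
  base_value b (k * b - a) d (k * d - c) X Y =
  base_value a b c d X Y - per (a * X + c * Y) (b * X + d * Y).
Proof.
move=> d0; rewrite /base_value; set Z := a * X + _; set W := b * X + _.
have -> : (k * b - a) * X + (k * d - c) * Y = k * W - Z by rewrite /Z /W; ring.
have nz : nonzero c d by rewrite /nonzero d0 orbT.
have nz' : nonzero (- c) (- d) by move: nz; rewrite /nonzero !oppr_eq0.
have := @equivariant_T (- k) (- c) (- d) W (k * W - Z) nz'.
rewrite psym_x0 !mul1r !mul0r !add0r !addr0.
have -> : - c + - k * - d = k * d - c by ring.
have -> : - k * W + (k * W - Z) = - Z by ring.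
move=> ->; rewrite psymNN.
have := @equivariant_S c d Z W nz.
rewrite psym_0y // !mul0r !mul1r !add0r !mulN1r !addr0 => e.
rewrite -(psymNN d) opprK e; ring.
Qed.

Definition ceil_div (a b : nat) := ((a + b.-1) %/ b)%N.

Lemma ceil_divP a b : (0 < b)%N -> (a <= ceil_div a b * b < a + b)%N.
Proof.
move=> b0; rewrite /ceil_div.
have := divn_eq (a + b.-1) b; have := ltn_pmod (a + b.-1) b0; lia.
Qed.

Lemma ceil_div_uniq a b k : (a <= k * b < a + b)%N -> ceil_div a b = k.
Proof.
move=> kP; have b0 : (0 < b)%N by lia.
have := ceil_divP a b0; nia.
Qed.

(** The matrices form chains in which ((a, b), (c, d)) is followed by ((b, k b - a), (d, k d - c)),
    k the ceiling of a / b, as in a continued fraction with minus signs. By [base_value_step] the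
    sum telescopes along each chain. Chains start at c = 0, where the base value vanishes, and end
    at b = 0, on the triangular representatives of T_n. *)
Lemma period_sum_boundary n X Y : period_sum n X Y =
  \sum_(p <- factor_pairs n) \sum_(0 <= c < p.2)
    (per (p.1%:Z * X + c%:Z * Y) (p.2%:Z * Y) - base_value p.1 0 c p.2 X Y).
Proof.
pose B (h : (nat * nat) * (nat * nat)) := - base_value h.1.1 h.1.2 h.2.1 h.2.2 X Y.
pose A (h : (nat * nat) * (nat * nat)) :=
  per (h.1.1%:Z * X + h.2.1%:Z * Y) (h.1.2%:Z * X + h.2.2%:Z * Y) + B h.
have -> : period_sum n X Y = \sum_(h <- merel n) A h - \sum_(h <- merel n) B h.
  by rewrite -sumrB; apply: eq_bigr => h _; rewrite addrK.
have step : \sum_(h <- merel n | h.1.2 != 0%N) A h = \sum_(h <- merel n | h.2.1 != 0%N) B h.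
  apply: (@big_seq_bij _ _ _ _ _ _ _
   (fun h => ((h.1.2, ceil_div h.1.1 h.1.2 * h.1.2 - h.1.1),
              (h.2.2, ceil_div h.1.1 h.1.2 * h.2.2 - h.2.1))%N)
   (fun h => ((ceil_div h.2.2 h.2.1 * h.1.1 - h.1.2, h.1.1),
              (ceil_div h.2.2 h.2.1 * h.2.1 - h.2.2, h.2.1))%N)); rewrite ?merel_uniq//.
    move=> [[a b] [c d]]; rewrite mem_merel => /and3P[ba cd /eqP e] b0.
    rewrite /= in ba cd e b0.
    have b0' : (0 < b)%N by rewrite lt0n.
    have := ceil_divP a b0'; set k := ceil_div a b; rewrite /= -/k => /andP[k1 k2].
    have k3 : (1 < k)%N by nia.
    have -> : ceil_div (k * d - c) d = k by apply: ceil_div_uniq; nia.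
    split.
    - by rewrite mem_merel /=; apply/and3P; split; try apply/eqP; nia.
    - lia.
    - by congr (_, _, (_, _)); nia.
    - rewrite /A /B /=.
      have kb : (k * b - a)%N%:Z = k%:Z * b%:Z - a%:Z by nia.
      have kd : (k * d - c)%N%:Z = k%:Z * d%:Z - c%:Z by nia.
      by rewrite kb kd base_value_step; [ring|lia].
  move=> [[a b] [c d]]; rewrite mem_merel => /and3P[ba cd /eqP e] c0.
  rewrite /= in ba cd e c0.
  have c0' : (0 < c)%N by rewrite lt0n.
  have := ceil_divP d c0'; set k := ceil_div d c; rewrite /= -/k => /andP[k1 k2].
  have k3 : (1 < k)%N by nia.
  have -> : ceil_div (k * a - b) a = k by apply: ceil_div_uniq; nia.
  split.
  - by rewrite mem_merel /=; apply/and3P; split; try apply/eqP; nia.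
  - lia.
  - by congr (_, _, (_, _)); nia.
rewrite (bigID (fun h => h.1.2 != 0%N)) /= step.
rewrite [X in _ - X](bigID (fun h => h.2.1 != 0%N)) /= opprD addrACA subrr add0r.
rewrite [X in _ - X]big1 ?subr0; last first.
  move=> h; rewrite negbK => /eqP e.
  by rewrite /B /base_value e oppr0 psym_x0 oppr0.
rewrite -(@big_allpairs_dep _ _ _ _ _ _ (fun (p : nat * nat) (c : nat) => (p, c)) (factor_pairs n)
  (fun p => index_iota 0 p.2)
  (fun x => per (x.1.1%:Z * X + x.2%:Z * Y) (x.1.2%:Z * Y) - base_value x.1.1 0 x.2 x.1.2 X Y)).
apply: (@big_seq_bij _ _ _ _ _ _ _
  (fun h => ((h.1.1, h.2.2), h.2.1)) (fun x => ((x.1.1, 0%N), (x.2, x.1.2)))).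
- exact: merel_uniq.
- apply: allpairs_uniq_dep; first exact: factor_pairs_uniq.
    by move=> ? _; exact: iota_uniq.
  by move=> -[? ?] [? ?] _ _ /= [-> ->].
- move=> [[a b] [c d]]; rewrite mem_merel => /and3P[ba cd /eqP e] b0.
  rewrite /= in ba cd e b0; move: b0; rewrite negbK => /eqP b0; subst b.
  split=> //; last by rewrite /A /B /= mul0r add0r.
  apply/allpairsPdep; exists (a, d), c; split=> //.
    by rewrite mem_factor_pairs /=; apply/and3P; split; try apply/eqP; lia.
  by rewrite mem_index_iota.
- move=> [[a d] c] /allpairsPdep[[a' d'] [c' [+ + [-> -> ->]]]] _.
  rewrite mem_factor_pairs mem_index_iota /= => /and3P[a0 d0 /eqP e] cd.
  by split => //; rewrite mem_merel /=; apply/and3P; split; try apply/eqP; lia.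
Qed.

(** * Binary forms and the uniqueness of the period polynomial *)

Definition binary_form n (q : nat -> int) (X Y : int) : int :=
  \sum_(k < n.+1) q k * X ^+ (n - k) * Y ^+ k.

Definition mul_linear (s t : int) (q : nat -> int) k : int :=
  s * q k + t * (if k is k'.+1 then q k' else 0).

Lemma binary_form_mul_linear n q s t X Y : q n.+1 = 0 ->
  binary_form n.+1 (mul_linear s t q) X Y = binary_form n q X Y * (s * X + t * Y).
Proof.
move=> qn; rewrite /binary_form /mul_linear.
under eq_bigr do rewrite !mulrDl.
rewrite big_split /= big_ord_recr /= qn mulr0 !mul0r addr0.
rewrite [X in _ + X]big_ord_recl /= mulr0 !mul0r add0r mulrDr !mulr_suml; congr (_ + _).
  apply: eq_bigr => k _; have kn : (k <= n)%N by rewrite -ltnS.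
  by rewrite (subSn kn) exprS; ring.
by apply: eq_bigr => k _; rewrite /bump /= add1n subSS exprS; ring.
Qed.

Lemma binary_form_eq0 n q : (forall t, binary_form n q 1 t = 0) ->
  forall k, (k <= n)%N -> q k = 0.
Proof.
move=> q0 k kn; pose r : {poly int} := \poly_(i < n.+1) q i.
have rt (t : int) : root r t.
  rewrite /root horner_poly; apply/eqP; rewrite -[RHS](q0 t).
  by apply: eq_bigr => i _; rewrite expr1n mulr1.
have [r0|r0] := eqVneq r 0.
  by have := congr1 (fun s : {poly int} => s`_k) r0; rewrite coef_poly ltnS kn coef0.
have : (size (map Posz (iota 0 n.+1)) < size r)%N.
  apply: (max_poly_roots r0); first by apply/allP.
  by rewrite map_inj_uniq ?iota_uniq // => ? ? [].
rewrite size_map size_iota => n_r.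
by have := leq_trans n_r (size_poly _ _); rewrite ltnn.
Qed.

Section PeriodCoefficients.
Variables a b c d : int.

(** [per] splits into ten linear factors over the integers, namely X, Y, X - Y and X + Y twice, X +
    2 Y, X - 2 Y, 2 X + Y, 2 X - Y; they are multiplied up after the substitution. *)
Definition period_coef : nat -> int :=
  let l s t := mul_linear (s * a + t * b) (s * c + t * d) in
  l 1 0 (l 0 1 (l 1 (-1) (l 1 (-1) (l 1 1 (l 1 1
    (l 1 2%:R (l 1 (- 2%:R) (l 2%:R 1 (l 2%:R (-1) (fun k => (k == 0%N)%:R)))))))))).

Lemma period_coefE X Y :
  per (a * X + c * Y) (b * X + d * Y) = binary_form 10 period_coef X Y.
Proof.
rewrite /period_coef !binary_form_mul_linear; try by rewrite /mul_linear /=; ring.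
by rewrite /binary_form big_ord1 /= /per; ring.
Qed.

Lemma period_coef1 : period_coef 1 =
  c * (36%:R * a ^+ 8 * b - 175%:R * a ^+ 6 * b ^+ 3 + 210%:R * a ^+ 4 * b ^+ 5
       - 75%:R * a ^+ 2 * b ^+ 7 + 4%:R * b ^+ 9)
  + d * (4%:R * a ^+ 9 - 75%:R * a ^+ 7 * b ^+ 2 + 210%:R * a ^+ 5 * b ^+ 4
       - 175%:R * a ^+ 3 * b ^+ 6 + 36%:R * a * b ^+ 8).
Proof. by rewrite /period_coef /mul_linear /=; ring. Qed.

End PeriodCoefficients.

Definition period_sum_coef n k : int :=
  \sum_(h <- merel n) period_coef h.1.1 h.1.2 h.2.1 h.2.2 k.

Lemma period_sumE n X Y : period_sum n X Y = binary_form 10 (period_sum_coef n) X Y.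
Proof.
rewrite /period_sum /binary_form /period_sum_coef.
under eq_bigr do rewrite period_coefE /binary_form.
by rewrite exchange_big; apply: eq_bigr => k _; rewrite !mulr_suml.
Qed.

(** A symmetric form of degree 10 has six free coefficients, and the three-term relation at eight
    integer points already determines them up to a scalar. *)
Lemma lewis_form q :
  (forall X Y, binary_form 10 q Y X = binary_form 10 q X Y) ->
  (forall X Y, binary_form 10 q X Y = binary_form 10 q X (X + Y) + binary_form 10 q (X + Y) Y) ->
  exists e : int, q 1%N = 4%:R * e /\ forall X Y, binary_form 10 q X Y = e * per X Y.
Proof.
move=> sym lewis.
have qC k : (k <= 10)%N -> q k = q (10 - k)%N.
  move=> k10; apply/eqP; rewrite -subr_eq0; apply/eqP.
  apply: (@binary_form_eq0 10 (fun k => q k - q (10 - k)%N)) => // t.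
  apply/eqP; rewrite -[0](subrr (binary_form 10 q 1 t)) -{2}sym; apply/eqP.
  rewrite /binary_form -sumrB !big_ord_recl !big_ord0 /= /bump /= !(subSS, subn0, addSn, add0n, expr1n); ring.
have qE X Y : binary_form 10 q X Y =
  q 0%N * (X ^+ 10 + Y ^+ 10) + q 1%N * (X ^+ 9 * Y + X * Y ^+ 9)
  + q 2 * (X ^+ 8 * Y ^+ 2 + X ^+ 2 * Y ^+ 8) + q 3 * (X ^+ 7 * Y ^+ 3 + X ^+ 3 * Y ^+ 7)
  + q 4 * (X ^+ 6 * Y ^+ 4 + X ^+ 4 * Y ^+ 6) + q 5 * (X ^+ 5 * Y ^+ 5).
  rewrite /binary_form !big_ord_recl !big_ord0 /= /bump /= !(subSS, subn0, addSn, add0n).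
  rewrite (qC 10) // (qC 9) // (qC 8) // (qC 7) // (qC 6) // !(subSS, subn0); ring.
have [q0 q2 q4 [q3 q5]] : [/\ q 0%N = 0, q 2 = 0, q 4 = 0 &
     4 * q 3 = - 25 * q 1%N /\ 2 * q 5 = 21 * q 1%N].
  have := lewis 1 (-1); have := lewis 1 1; have := lewis 2 (-1); have := lewis 3 (-1).
  have := lewis 1 2; have := lewis 1 (-3); have := lewis 3 (-2); have := lewis 4 (-1).
  rewrite !qE => {sym lewis qC qE}.
  split; [lra..|split; lra].
have [e q1] : exists e : int, q 1%N = 4 * e.
  (* The multiplier is integral because the coefficients 4 and -25 of [per] satisfy 25 - 6 * 4 =
     1. *)
  by exists (- q 3 - 6 * q 1%N); lra.
exists e; split => // X Y; rewrite qE q0 q2 q4 /per.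
have -> : q 3 = -25 * e by lra.
have -> : q 5 = 42 * e by lra.
by rewrite q1; ring.
Qed.

(** * Hecke operators *)

Definition hecke (p : nat) (G : int -> int -> int -> int -> int) (x y X Y : int) : int :=
  \sum_(0 <= c < p) G (p%:Z * x) (y - c%:Z * x) (X + c%:Z * Y) (p%:Z * Y)
  + G x (p%:Z * y) (p%:Z * X) Y.

(* The equivariance and homogeneity properties characterising multiples of [psym]. *)
Record symbol (G : int -> int -> int -> int -> int) : Prop := Symbol {
  symbol_x0 : forall x X Y, x != 0 -> G x 0 X Y = G 1 0 X Y;
  symbol_0y : forall y X Y, y != 0 -> G 0 y X Y = G 0 1 X Y;
  symbol_shear : exists K : int -> int -> int, forall x y X Y, nonzero x y ->
    G x (x + y) X Y = G x y (X + Y) Y + K X Y;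
  symbol_swap : exists K : int -> int -> int, forall x y X Y, nonzero x y ->
    G y x Y X = K X Y - G x y X Y }.

(** The vanishing at 1 / 0 and 0 / 1 forces both functions [K] to vanish, so the shears act without
    correction and descent on |x| + |y| reaches an axis. *)
Lemma symbol_eq0 G : symbol G -> (forall X Y, G 1 0 X Y = 0) -> (forall X Y, G 0 1 X Y = 0) ->
  forall x y X Y, nonzero x y -> G x y X Y = 0.
Proof.
case=> Gx Gy [K KP] [L LP] G10 G01.
have nz01 : nonzero 0 1 by [].
have nz10 : nonzero 1 0 by [].
have K0 X Y : K X Y = 0.
  by have := KP _ _ X Y nz01; rewrite add0r !G01 add0r.
have L0 X Y : L X Y = 0.
  by have := LP _ _ X Y nz10; rewrite G01 G10 subr0.
have shear' x y X Y : nonzero x y -> G x (x + y) X Y = G x y (X + Y) Y.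
  by move=> xy; rewrite KP // K0 addr0.
have swap x y X Y : nonzero x y -> G y x Y X = - G x y X Y.
  by move=> xy; rewrite LP // L0 sub0r.
have shear x y X Y : nonzero x y -> G (x + y) y X Y = G x y X (X + Y).
  move=> xy; have yx : nonzero y x by move: xy; rewrite /nonzero; lia.
  rewrite swap; last by move: xy; rewrite /nonzero; lia.
  by rewrite (addrC x) shear' // swap // opprK addrC.
move=> x y; move: {2}(`|x| + `|y|)%N (leqnn (`|x| + `|y|)%N) => k.
elim: k x y => [|k IH] x y le_k X Y xy; first by move: le_k xy; rewrite /nonzero; lia.
have [y0|y0] := eqVneq y 0.
  by move: xy; rewrite y0 /nonzero eqxx orbF => x0; rewrite Gx.
have [x0|x0] := eqVneq x 0; first by rewrite x0 Gy.
have nz1 (z : int) : nonzero z y by rewrite /nonzero y0 orbT.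
have nz2 (z : int) : nonzero x z by rewrite /nonzero x0.
have [|xy0] := lerP 0 (x * y) => [xy0|].
  have [le_xy|lt_xy] := leqP `|y|%N `|x|%N.
    by have := shear (x - y) y X Y (nz1 _); rewrite subrK => ->; apply: IH => //; nia.
  have := shear' x (y - x) X Y (nz2 _); rewrite (addrC x) subrK => ->; apply: IH => //; nia.
have [le_xy|lt_xy] := leqP `|y|%N `|x|%N.
  have := shear x y X (Y - X) (nz1 _); rewrite (addrC X) subrK => <-; apply: IH => //; nia.
have := shear' x y (X - Y) Y (nz2 _); rewrite subrK => <-; apply: IH => //; nia.
Qed.

Lemma symbol_lin G e : symbol G -> symbol (fun x y X Y => G x y X Y - e * psym x y X Y - G 1 0 X Y).
Proof.
case=> Gx Gy [K KP] [L LP]; split.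
- by move=> x X Y x0; rewrite Gx // !psym_x0.
- by move=> y X Y y0; rewrite Gy // !psym_0y.
- exists (fun X Y => K X Y - e * (per X Y - per (X + Y) Y) - G 1 0 X Y + G 1 0 (X + Y) Y).
  by move=> x y X Y xy; rewrite KP // psym_shear' //; ring.
exists (fun X Y => L X Y - e * per X Y - G 1 0 Y X - G 1 0 X Y).
by move=> x y X Y xy; rewrite LP // psymC //; ring.
Qed.

(** Multiplicity one: the jump inherits symmetry from the swap and the three-term relation from the
    shear, so it is a multiple of [per]; subtracting that multiple of [psym] leaves a symbol
    vanishing at both basic cusps. *)
Lemma symbol_multiple G q : symbol G ->
  (forall X Y, G 0 1 X Y - G 1 0 X Y = binary_form 10 q X Y) ->
  exists e, [/\ q 1%N = 4%:R * e, forall X Y, G 0 1 X Y - G 1 0 X Y = e * per X Y &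
    forall x y X Y, nonzero x y -> G x y X Y = e * psym x y X Y + G 1 0 X Y].
Proof.
move=> sG qE; have [Gx Gy [K KP] [L LP]] := sG.
have nz01 : nonzero 0 1 by [].
have nz10 : nonzero 1 0 by [].
have nz11 : nonzero 1 1 by [].
have [|X Y|e [q1 eE]] := @lewis_form q.
- move=> X Y; rewrite -!qE; have := LP _ _ X Y nz01; have := LP _ _ X Y nz10; lra.
- rewrite -!qE.
  have := LP _ _ X Y nz11; have := LP _ _ X Y nz10; have := LP _ _ X (X + Y) nz10.
  have := LP _ _ X (X + Y) nz01.
  have := KP _ _ X Y nz10; have := KP _ _ Y X nz10; have := KP _ _ X Y nz01; have := KP _ _ Y X nz01.
  rewrite !addr0 !add0r (addrC Y X); lra.
exists e; split => // [X Y|x y X Y xy]; first by rewrite qE eE.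
have := symbol_eq0 (symbol_lin e sG) _ _ X Y xy.
move=> H; apply/eqP; rewrite -subr_eq0 opprD addrA; apply/eqP; apply: H => {}X {}Y.
  by rewrite psym_x0; ring.
by rewrite psym_0y // -eE -qE; ring.
Qed.

Lemma factor_pairs_pfactor p e : prime p ->
  perm_eq (factor_pairs (p ^ e)) [seq (p ^ i, p ^ (e - i))%N | i <- iota 0 e.+1].
Proof.
move=> pp; have p1 := prime_gt1 pp; apply: uniq_perm; first exact: factor_pairs_uniq.
  rewrite map_inj_uniq ?iota_uniq // => i j [/eqP].
  by rewrite eqn_exp2l // => /eqP.
move=> [a b]; rewrite mem_factor_pairs; apply/and3P/mapP => [[a0 b0 /eqP e_ab]|[i + [-> ->]]].
  rewrite /= in a0 b0 e_ab.
  have /(dvdn_pfactor _ _ pp) [i ie a_eq] : (a %| p ^ e)%N by rewrite -e_ab dvdn_mulr.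
  exists i; first by rewrite mem_iota.
  by rewrite a_eq expnB ?prime_gt0 // -e_ab a_eq mulKn // expn_gt0 prime_gt0.
rewrite mem_iota add0n ltnS => /andP[_ ie] /=.
by rewrite !expn_gt0 prime_gt0 // -expnD subnKC.
Qed.

Lemma sum_nat_block (V : nmodType) m p (f : nat -> V) :
  \sum_(0 <= k < m * p) f k = \sum_(0 <= c < p) \sum_(0 <= j < m) f (c + j * p)%N.
Proof.
rewrite exchange_big_nat /=; elim: m => [|m IH]; first by rewrite !big_geq.
rewrite big_nat_recr //= -IH mulSnr (@big_cat_nat _ _ _ (m * p)) ?leq_addr //=; congr (_ + _).
by rewrite -[X in \sum_(X <= _ < _) _]add0n big_addn addKn.
Qed.

Section HeckePrime.
Variable p : nat.
Hypothesis p_prime : prime p.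

Let p_gt0 := prime_gt0 p_prime.
Let p_neq0 : p%:Z != 0. Proof. by rewrite eqz_nat -lt0n. Qed.

Let inv c := (c ^ p.-2 %% p)%N.

Let invP c : (0 < c < p)%N -> (0 < inv c < p)%N /\ (c * inv c = 1 %[mod p])%N.
Proof.
move=> /andP[c0 cp]; have cop : coprime c p.
  by rewrite coprime_sym prime_coprime // gtnNdvd.
rewrite /inv ltn_mod p_gt0 andbT lt0n; split.
  rewrite -[_ == _]/(p %| _)%N; by rewrite Euclid_dvdX // gtnNdvd.
rewrite modnMmr -expnS; have -> : p.-2.+1 = totient p.
  by rewrite totient_prime //; have := prime_gt1 p_prime; lia.
exact: cyclic.Euler_exp_totient.
Qed.

Let invK c : (0 < c < p)%N -> inv (inv c) = c.
Proof.
move=> c0p; have [ic e] := invP c0p; have [iic e'] := invP ic.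
have : (c = inv (inv c) %[mod p])%N.
  rewrite -[X in (X = _ %[mod p])%N]muln1 -modnMmr -e' modnMmr mulnA.
  by rewrite -modnMml e modnMml mul1n.
by move: iic c0p => /andP[_ h] /andP[_ h']; rewrite !modn_small.
Qed.

Let int_inv c : (0 < c < p)%N -> exists m : int, c%:Z * (inv c)%:Z = 1 - m * p%:Z.
Proof.
move=> c0p; have [_ e] := invP c0p.
exists (- ((c * inv c) %/ p)%N%:Z); rewrite -PoszM [in LHS](divn_eq (c * inv c) p) e.
by rewrite modn_small ?prime_gt1 // PoszD PoszM; ring.
Qed.

(** Exchanging x and y takes the representative c to its inverse modulo p, by the matrix ((m, -c),
    (inv c, p)) of determinant 1 with m p = 1 - c (inv c). *)
Lemma hecke_swap_term c X Y x y : (0 < c < p)%N -> nonzero x y ->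
  psym (p%:Z * y) (x - c%:Z * y) (Y + c%:Z * X) (p%:Z * X) =
  per (p%:Z * X) (Y + c%:Z * X)
  - psym ((1 - c%:Z * (inv c)%:Z) %/ p%:Z)%Z (inv c) (p%:Z * X) (Y + c%:Z * X)
  - psym (p%:Z * x) (y - (inv c)%:Z * x) (X + (inv c)%:Z * Y) (p%:Z * Y).
Proof.
move=> c0p xy; have [m em] := int_inv c0p.
have -> : ((1 - c%:Z * (inv c)%:Z) %/ p%:Z)%Z = m by rewrite em opprB addrC subrK mulzK.
rewrite (psymC (p%:Z * X) (Y + c%:Z * X)); last first.
  move: xy; rewrite /nonzero -!negb_and; apply: contra => /andP[/eqP e /eqP].
  move/eqP: e; rewrite subr_eq0 => /eqP -> /eqP.
  by rewrite mulf_eq0 (negPf p_neq0) /= => /eqP ->; rewrite mulr0 eqxx.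
have det : m * p%:Z - - c%:Z * (inv c)%:Z = 1 by rewrite mulNr opprK em; ring.
have nz : nonzero (p%:Z * x) (y - (inv c)%:Z * x).
  move: xy; rewrite /nonzero -!negb_and; apply: contra => /andP[+ /eqP e].
  rewrite mulf_eq0 (negPf p_neq0) /= => /eqP x0; move: e.
  by rewrite x0 mulr0 subr0 => ->; rewrite eqxx.
have := @equivariant_SL2 _ _ _ _ det _ _ (p%:Z * X) (Y + c%:Z * X) nz.
have -> : m * (p%:Z * x) + - c%:Z * (y - (inv c)%:Z * x) = x - c%:Z * y.
  by transitivity ((m * p%:Z - - c%:Z * (inv c)%:Z) * x - c%:Z * y); [ring|rewrite det mul1r].
have -> : (inv c)%:Z * (p%:Z * x) + p%:Z * (y - (inv c)%:Z * x) = p%:Z * y by ring.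
have -> : m * (p%:Z * X) + (inv c)%:Z * (Y + c%:Z * X) = X + (inv c)%:Z * Y.
  by transitivity ((m * p%:Z - - c%:Z * (inv c)%:Z) * X + (inv c)%:Z * Y); [ring|rewrite det mul1r].
have -> : - c%:Z * (p%:Z * X) + p%:Z * (Y + c%:Z * X) = p%:Z * Y by ring.
by move=> ->; ring.
Qed.

Lemma hecke_symbol : symbol (hecke p psym).
Proof.
split.
- move=> x X Y x0; rewrite /hecke !mulr0 !psym_x0 !addr0.
  apply: eq_bigr => c _; rewrite !sub0r !mulr1 -[RHS](@psym_scale x) //.
  by rewrite mulrC (mulrC c%:Z) mulrN.
- move=> y X Y y0; rewrite /hecke !mulr0 !psym_0y ?mulf_neq0 //; congr (_ + _).
  by apply: eq_bigr => c _; rewrite !mulr0 !subr0 !psym_0y.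
- exists (fun X Y => per (p%:Z * 0 + X) (p%:Z * Y) - per (X + p%:Z * Y) (p%:Z * Y) +
                     psym 1 p (p%:Z * X) Y).
  move=> x y X Y xy; rewrite /hecke.
  have nz z : nonzero (p%:Z * x) (y - z * x).
    move: xy; rewrite /nonzero -!negb_and; apply: contra => /andP[+ /eqP e].
    rewrite mulf_eq0 (negPf p_neq0) /= => /eqP x0; move: e.
    by rewrite x0 mulr0 subr0 => ->; rewrite eqxx.
  have -> : p = p.-1.+1 by rewrite prednK.
  rewrite big_nat_recl // [in RHS]big_nat_recr //= prednK //.
  (* The shear turns the term c = i + 1 into c = i. The term c = 0 wraps around to c = p - 1 by one
     more shear, whose correction depends only on X and Y. *)
  have -> : \sum_(0 <= i < p.-1) psym (p%:Z * x) (x + y - i.+1%:Z * x) (X + i.+1%:Z * Y) (p%:Z * Y) =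
            \sum_(0 <= i < p.-1) psym (p%:Z * x) (y - i%:Z * x) (X + Y + i%:Z * Y) (p%:Z * Y).
    by apply: eq_bigr => i _; congr (psym _ _ _ _); rewrite -addn1 PoszD; ring.
  have e1 := psym_shear' X (p%:Z * Y) (nz (p%:Z - 1)).
  have e1' : p%:Z * x + (y - (p%:Z - 1) * x) = x + y - 0%:Z * x by ring.
  have e1'' : X + 0%:Z * Y = X by ring.
  rewrite e1'' -e1' e1 mulr0 add0r.
  have det : 1 * 1 - 0 * p%:Z = 1 :> int by ring.
  have nz' : nonzero x (p%:Z * y).
    by move: xy; rewrite /nonzero mulf_eq0 (negPf p_neq0).
  have := @equivariant_SL2 _ _ _ _ det _ _ (p%:Z * X) Y nz'.
  rewrite !mul1r !mul0r !addr0 !add0r -mulrDr => ->.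
  have -> : (p.-1)%:Z = p%:Z - 1 by lia.
  have -> : X + Y + (p%:Z - 1) * Y = X + p%:Z * Y by ring.
  rewrite mulrDr; ring.
exists (fun X Y => \sum_(1 <= c < p) (per (p%:Z * X) (Y + c%:Z * X)
  - psym ((1 - c%:Z * (inv c)%:Z) %/ p%:Z)%Z (inv c) (p%:Z * X) (Y + c%:Z * X))
  + per (p%:Z * X) Y + per X (p%:Z * Y)).
move=> x y X Y xy; rewrite /hecke !(big_ltn p_gt0) !mul0r ?subr0 ?addr0.
have nz : nonzero x (p%:Z * y) by move: xy; rewrite /nonzero mulf_eq0 (negPf p_neq0).
have nz' : nonzero (p%:Z * x) y by move: xy; rewrite /nonzero mulf_eq0 (negPf p_neq0).
rewrite (psymC (p%:Z * X) Y nz) (psymC X (p%:Z * Y) nz').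
have -> : \sum_(1 <= c < p) psym (p%:Z * y) (x - c%:Z * y) (Y + c%:Z * X) (p%:Z * X) =
  \sum_(1 <= c < p) (per (p%:Z * X) (Y + c%:Z * X)
  - psym ((1 - c%:Z * (inv c)%:Z) %/ p%:Z)%Z (inv c) (p%:Z * X) (Y + c%:Z * X)) -
  \sum_(1 <= c < p) psym (p%:Z * x) (y - (inv c)%:Z * x) (X + (inv c)%:Z * Y) (p%:Z * Y).
  by rewrite -sumrB; apply: eq_big_nat => c c0p; rewrite hecke_swap_term.
have -> : \sum_(1 <= c < p) psym (p%:Z * x) (y - (inv c)%:Z * x) (X + (inv c)%:Z * Y) (p%:Z * Y) =
  \sum_(1 <= c < p) psym (p%:Z * x) (y - c%:Z * x) (X + c%:Z * Y) (p%:Z * Y).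
  apply: (@big_seq_bij _ _ _ _ _ _ _ inv inv); rewrite ?iota_uniq // => c;
    rewrite mem_index_iota => c0p _; have [ic _] := invP c0p;
    by rewrite mem_index_iota ic invK.
ring.
Qed.

(** The operator T_(p^e), as a sum over triangular matrices of determinant p^e. *)
Definition hecke_pow e (x y X Y : int) : int :=
  \sum_(0 <= i < e.+1) \sum_(0 <= c < p ^ (e - i))
    psym ((p ^ (e - i))%N%:Z * x) ((p ^ i)%N%:Z * y - c%:Z * x)
         ((p ^ i)%N%:Z * X + c%:Z * Y) ((p ^ (e - i))%N%:Z * Y).

Lemma hecke_pow0 x y X Y : hecke_pow 0 x y X Y = psym x y X Y.
Proof.
rewrite /hecke_pow big_nat1 subnn expn0 big_nat1.
by congr (psym _ _ _ _); ring.
Qed.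

Lemma hecke_pow1 x y X Y : hecke_pow 1 x y X Y = hecke p psym x y X Y.
Proof.
rewrite /hecke_pow big_nat_recl // big_nat1 subn0 subnn expn0 expn1 big_nat1 /hecke.
congr (_ + psym _ _ _ _); try ring.
by apply: eq_bigr => c _; congr (psym _ _ _ _); ring.
Qed.

Lemma hecke_pow_jump e X Y : hecke_pow e 0 1 X Y - hecke_pow e 1 0 X Y = period_sum (p ^ e) X Y.
Proof.
rewrite period_sum_boundary (perm_big _ (factor_pairs_pfactor e p_prime)) big_map.
rewrite /hecke_pow /index_iota subn0 -sumrB; apply: eq_bigr => i _.
rewrite -sumrB; apply: eq_bigr => c _; rewrite !mulr0 !mulr1 subr0 sub0r psym_0y //.
  by rewrite /base_value mul0r add0r.
by rewrite eqz_nat -lt0n expn_gt0 p_gt0.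
Qed.

(** Moving a window of D consecutive c by one replaces a single term by its shear, at the cost of a
    function of X and Y. *)
Lemma psym_sum_shift (D : nat) (B : int) h : (0 < D)%N -> B != 0 ->
  exists K : int -> int -> int, forall x y X Y, nonzero x y ->
  \sum_(0 <= c < D) psym (D%:Z * x) (B * y - (h + c)%N%:Z * x) (B * X + (h + c)%N%:Z * Y) (D%:Z * Y)
  = \sum_(0 <= c < D) psym (D%:Z * x) (B * y - c%:Z * x) (B * X + c%:Z * Y) (D%:Z * Y) + K X Y.
Proof.
move=> D0 B0; have D0' : D%:Z != 0 by rewrite eqz_nat -lt0n.
elim: h => [|h [K IH]].
  by exists (fun _ _ => 0) => x y X Y _; rewrite addr0.
exists (fun X Y => K X Y + (per (B * X + h%:Z * Y + D%:Z * Y) (D%:Z * Y)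
                            - per (B * X + h%:Z * Y) (D%:Z * Y))).
move=> x y X Y xy; rewrite addrA -IH //.
pose Phi k := psym (D%:Z * x) (B * y - k%:Z * x) (B * X + k%:Z * Y) (D%:Z * Y).
have -> : \sum_(0 <= c < D) Phi (h.+1 + c)%N = \sum_(0 <= c < D) Phi (h + c)%N - Phi h + Phi (h + D)%N.
  case: (D) D0 => // n _; rewrite big_nat_recr //= [in RHS]big_nat_recl // addn0.
  rewrite addnS addSn [X in X + _ = _](_ : _ = \sum_(0 <= i < n) Phi (h + i.+1)%N); first by ring.
  by apply: eq_bigr => i _; rewrite addnS addSn.
suff -> : Phi (h + D)%N = Phi h + (per (B * X + h%:Z * Y + D%:Z * Y) (D%:Z * Y)
                            - per (B * X + h%:Z * Y) (D%:Z * Y)) by ring.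
have nz : nonzero (D%:Z * x) (B * y - (h + D)%N%:Z * x).
  move: xy; rewrite /nonzero -!negb_and; apply: contra => /andP[+ /eqP e].
  rewrite mulf_eq0 (negPf D0') /= => /eqP x0; move/eqP: e.
  by rewrite x0 mulr0 subr0 mulf_eq0 (negPf B0) /= => ->.
have := psym_shear' (B * X + h%:Z * Y) (D%:Z * Y) nz.
have -> : D%:Z * x + (B * y - (h + D)%N%:Z * x) = B * y - h%:Z * x by rewrite PoszD; ring.
have -> : B * X + h%:Z * Y + D%:Z * Y = B * X + (h + D)%N%:Z * Y by rewrite PoszD; ring.
by rewrite /Phi => ->; ring.
Qed.

(** The products divisible by p reproduce each term of T_(p^e) p times, with c shifted; dividing out
    p gives p^10 by homogeneity, hence p^11 in total. The other products are the terms of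
    T_(p^(e+2)). *)
Lemma hecke_hecke_pow e : exists K : int -> int -> int, forall x y X Y, nonzero x y ->
  hecke p (hecke_pow e.+1) x y X Y =
  hecke_pow e.+2 x y X Y + p%:Z ^+ 11 * hecke_pow e x y X Y + K X Y.
Proof.
have [K KP] : exists K : nat -> nat -> int -> int -> int, forall j c x y X Y, nonzero x y ->
    \sum_(0 <= c' < p ^ (e - j)) psym ((p ^ (e - j))%N%:Z * x)
       ((p ^ j)%N%:Z * y - (p ^ j * c + c')%N%:Z * x)
       ((p ^ j)%N%:Z * X + (p ^ j * c + c')%N%:Z * Y) ((p ^ (e - j))%N%:Z * Y) =
    \sum_(0 <= c' < p ^ (e - j)) psym ((p ^ (e - j))%N%:Z * x) ((p ^ j)%N%:Z * y - c'%:Z * x)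
       ((p ^ j)%N%:Z * X + c'%:Z * Y) ((p ^ (e - j))%N%:Z * Y) + K j c X Y.
  have pow0 k : (0 < p ^ k)%N by rewrite expn_gt0 p_gt0.
  have pow0' k : (p ^ k)%N%:Z != 0 by rewrite eqz_nat -lt0n.
  have /choice[K KP] := fun jc : nat * nat =>
    psym_sum_shift (p ^ jc.1 * jc.2)%N (pow0 (e - jc.1)%N) (pow0' jc.1).
  by exists (fun j c => K (j, c)) => j c; apply: (KP (j, c)).
exists (fun X Y => p%:Z ^+ 10 * \sum_(0 <= j < e.+1) \sum_(0 <= c < p) K j c X Y).
move=> x y X Y xy; rewrite {1}/hecke.
have -> : hecke_pow e.+1 x (p%:Z * y) (p%:Z * X) Y =
  \sum_(0 <= i < e.+2) \sum_(0 <= c < p ^ (e.+2 - i.+1))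
    psym ((p ^ (e.+2 - i.+1))%N%:Z * x) ((p ^ i.+1)%N%:Z * y - c%:Z * x)
         ((p ^ i.+1)%N%:Z * X + c%:Z * Y) ((p ^ (e.+2 - i.+1))%N%:Z * Y).
  apply: eq_bigr => i _; rewrite subSS; apply: eq_bigr => c _.
  by congr (psym _ _ _ _); rewrite expnS PoszM; ring.
have -> : \sum_(0 <= c < p) hecke_pow e.+1 (p%:Z * x) (y - c%:Z * x) (X + c%:Z * Y) (p%:Z * Y) =
  \sum_(0 <= c < p ^ e.+2) psym ((p ^ e.+2)%N%:Z * x) ((p ^ 0)%N%:Z * y - c%:Z * x)
         ((p ^ 0)%N%:Z * X + c%:Z * Y) ((p ^ e.+2)%N%:Z * Y) +
  p%:Z ^+ 10 * (p%:Z * hecke_pow e x y X Y + \sum_(0 <= j < e.+1) \sum_(0 <= c < p) K j c X Y).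
  rewrite /hecke_pow exchange_big_nat big_nat_recl //=; congr (_ + _).
    rewrite subn0 [(p ^ e.+2)%N]expnSr sum_nat_block; apply: eq_bigr => c _.
    apply: eq_bigr => j _.
    by congr (psym _ _ _ _); rewrite ?expn0 ?expnSr ?PoszD ?PoszM; ring.
  rewrite mulr_sumr -big_split mulr_sumr /=; apply: eq_bigr => j _.
  set S := \sum_(0 <= c < p ^ (e - j)) _.
  have -> : p%:Z * S = \sum_(0 <= c < p) S by rewrite sumr_const_nat subn0 -mulr_natl natz.
  rewrite -big_split mulr_sumr /=; apply: eq_bigr => c _; rewrite -KP // subSS mulr_sumr.
  apply: eq_bigr => c' _; rewrite -psym_hom -[RHS](@psym_scale p%:Z) //.
  by congr (psym _ _ _ _); rewrite ?expnS ?PoszD ?PoszM; ring.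
rewrite [hecke_pow e.+2 _ _ _ _]/hecke_pow [in RHS]big_nat_recl // subn0.
by ring.
Qed.

Lemma hecke_lin e (K : int -> int -> int) G x y X Y : nonzero x y ->
  (forall x y X Y, nonzero x y -> G x y X Y = e * psym x y X Y + K X Y) ->
  hecke p G x y X Y = e * hecke p psym x y X Y +
   (\sum_(0 <= c < p) K (X + c%:Z * Y) (p%:Z * Y) + K (p%:Z * X) Y).
Proof.
move=> xy GE; rewrite /hecke GE; last by move: xy; rewrite /nonzero mulf_eq0 (negPf p_neq0).
have -> : \sum_(0 <= c < p) G (p%:Z * x) (y - c%:Z * x) (X + c%:Z * Y) (p%:Z * Y) =
  e * \sum_(0 <= c < p) psym (p%:Z * x) (y - c%:Z * x) (X + c%:Z * Y) (p%:Z * Y) +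
  \sum_(0 <= c < p) K (X + c%:Z * Y) (p%:Z * Y).
  rewrite mulr_sumr -big_split; apply: eq_bigr => c _; rewrite GE //.
  move: xy; rewrite /nonzero -!negb_and; apply: contra => /andP[+ /eqP e0].
  rewrite mulf_eq0 (negPf p_neq0) /= => /eqP x0; move: e0.
  by rewrite x0 mulr0 subr0 => ->; rewrite eqxx.
ring.
Qed.

Definition hecke_eigen k t := exists K : int -> int -> int, forall x y X Y, nonzero x y ->
  hecke_pow k x y X Y = t * psym x y X Y + K X Y.

(* The coefficient of X^9 Y; [per] has leading term 4 X^9 Y. *)
Lemma hecke_eigen_coef k t : hecke_eigen k t -> period_sum_coef (p ^ k) 1 = 4%:R * t.
Proof.
move=> [K KP]; have sq X Y : binary_form 10 (period_sum_coef (p ^ k)) X Y = t * per X Y.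
  by rewrite -period_sumE -hecke_pow_jump !KP // psym_x0 psym_0y //; ring.
pose q j := period_sum_coef (p ^ k) j - t * period_coef 1 0 0 1 j.
have := @binary_form_eq0 10 q _ 1%N isT; rewrite /q period_coef1 => q1.
apply/eqP; rewrite -subr_eq0; apply/eqP; rewrite -[RHS]q1; first by ring.
move=> s; have perE : per 1 s = binary_form 10 (period_coef 1 0 0 1) 1 s.
  by rewrite -period_coefE; congr per; ring.
have := sq 1 s => /eqP; rewrite -subr_eq0 perE => /eqP h; rewrite -[RHS]h.
rewrite /binary_form mulr_sumr -sumrB; apply: eq_bigr => j _; ring.
Qed.

Lemma hecke_eigen0 : hecke_eigen 0 1.
Proof. by exists (fun _ _ => 0) => x y X Y _; rewrite hecke_pow0; ring. Qed.

Lemma hecke_eigen1 : exists t, hecke_eigen 1 t.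
Proof.
have [X Y|t [_ _ tE]] := symbol_multiple (q := period_sum_coef p) hecke_symbol.
  by rewrite -!hecke_pow1 hecke_pow_jump expn1 period_sumE.
by exists t, (hecke p psym 1 0) => x y X Y xy; rewrite hecke_pow1 tE.
Qed.

Lemma hecke_eigenSS k t1 s t : hecke_eigen 1 t1 -> hecke_eigen k.+1 s -> hecke_eigen k t ->
  hecke_eigen k.+2 (t1 * s - p%:Z ^+ 11 * t).
Proof.
move=> [K1 E1] [Ks Es] [Kt Et]; have [K KP] := hecke_hecke_pow k.
exists (fun X Y => s * K1 X Y + (\sum_(0 <= c < p) Ks (X + c%:Z * Y) (p%:Z * Y) + Ks (p%:Z * X) Y)
                   - p%:Z ^+ 11 * Kt X Y - K X Y).
move=> x y X Y xy; have := KP x y X Y xy.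
rewrite (hecke_lin X Y xy Es) -hecke_pow1 E1 // Et // => e.
by rewrite -[LHS](addrK (p%:Z ^+ 11 * (t * psym x y X Y + Kt X Y) + K X Y)) addrA -e; ring.
Qed.

Lemma hecke_eigen_exists k : exists t, hecke_eigen k t.
Proof.
suff [] : (exists t, hecke_eigen k t) /\ (exists t, hecke_eigen k.+1 t) by [].
elim: k => [|k [[t Et] [s Es]]]; first by split; [exists 1; exact: hecke_eigen0|exact: hecke_eigen1].
split; first by exists s.
by have [t1 E1] := hecke_eigen1; eexists; exact: hecke_eigenSS E1 Es Et.
Qed.

End HeckePrime.

(** * Identification of the Hecke eigenvalues with tau *)

(** With u = a - b and v = d - c one has a d - b c = a v + u c. Matrices with c > 0 become
    quadruples with u <= a; those with c = 0 give the last sum. *)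
Lemma period_sum_coef1E n (W := fun a u c v : int => period_coef a (a - u) c (c + v) 1) :
  period_sum_coef n 1 =
  lsum n (fun q => q.2.1 < q.1.1)%N W + lsum n (fun q => q.1.1 == q.2.1) W +
  \sum_(p <- factor_pairs n) \sum_(1 <= u < p.1.+1) W p.1%:Z u%:Z 0 p.2%:Z.
Proof.
pose C (h : (nat * nat) * (nat * nat)) := period_coef h.1.1 h.1.2 h.2.1 h.2.2 1.
rewrite /period_sum_coef -/C (bigID (fun h => h.2.1 == 0%N)) /= addrC; congr (_ + _).
  have -> : lsum n (fun q => q.2.1 < q.1.1)%N W + lsum n (fun q => q.1.1 == q.2.1) W =
            lsum n (fun q => q.2.1 <= q.1.1)%N W.
    rewrite /lsum [RHS](bigID (fun q => q.2.1 < q.1.1)%N) /=; congr (_ + _).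
      by apply: eq_bigl => q; case: ltngtP.
    by apply: eq_bigl => q; case: ltngtP.
  apply: (@big_seq_bij _ _ _ _ _ _ _
    (fun h => ((h.1.1, h.2.2 - h.2.1), (h.1.1 - h.1.2, h.2.1))%N)
    (fun q => ((q.1.1, q.1.1 - q.2.1), (q.2.2, q.2.2 + q.1.2))%N));
    rewrite ?merel_uniq ?liouville_uniq //.
    move=> [[a b] [c d]]; rewrite mem_merel => /and3P[ba cd /eqP e] c0.
    rewrite /= in ba cd e c0; split.
    - by rewrite mem_liouville /=; apply/and5P; split; try apply/eqP; nia.
    - rewrite /=; lia.
    - by congr (_, _, (_, _)); rewrite /=; lia.
    - by rewrite /W /=; congr (period_coef _ _ _ _ _); lia.
  move=> [[a v] [u c]]; rewrite mem_liouville => /and5P[a0 v0 u0 c0 /eqP e] ua.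
  rewrite /= in a0 v0 u0 c0 e ua; split.
  - by rewrite mem_merel /=; apply/and3P; split; try apply/eqP; nia.
  - rewrite /=; lia.
  - by congr (_, _, (_, _)); rewrite /=; lia.
rewrite -(@big_allpairs_dep _ _ _ _ _ _ (fun (p : nat * nat) (u : nat) => (p, u)) (factor_pairs n)
  (fun p => index_iota 1 p.1.+1) (fun x => W x.1.1%:Z x.2%:Z 0 x.1.2%:Z)).
apply: (@big_seq_bij _ _ _ _ _ _ _
  (fun h => ((h.1.1, h.2.2), h.1.1 - h.1.2)%N)
  (fun x => ((x.1.1, x.1.1 - x.2), (0, x.1.2))%N)).
- exact: merel_uniq.
- apply: allpairs_uniq_dep; first exact: factor_pairs_uniq.
    by move=> ? _; exact: iota_uniq.
  by move=> -[? ?] [? ?] _ _ /= [-> ->].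
- move=> [[a b] [c d]]; rewrite mem_merel => /and3P[ba cd /eqP e] /eqP c0.
  rewrite /= in ba cd e c0; subst c; split.
  + apply/allpairsPdep; exists (a, d), (a - b)%N; split=> //.
      by rewrite mem_factor_pairs /=; apply/and3P; split; try apply/eqP; lia.
    by rewrite mem_index_iota /=; lia.
  + by [].
  + by congr (_, _, (_, _)); rewrite /=; lia.
  + by rewrite /C /W /=; congr (period_coef _ _ _ _ _); lia.
- move=> [[a d] u] /allpairsPdep[[a' d'] [u' [+ + [-> -> ->]]]] _.
  rewrite mem_factor_pairs mem_index_iota => /and3P[a0 d0 /eqP e] /andP[u0 ua].
  rewrite /= in a0 d0 e u0 ua; split => //.
    by rewrite mem_merel /=; apply/and3P; split; try apply/eqP; lia.
  by congr (_, _, _); rewrite /=; lia.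
Qed.

(** Liouville's identity applies to W - 280 Psi, where Psi symmetrises the summand of [tau_conv].
    The contributions of a = u cancel ([diag]), and the remaining power sums over divisors yield the
    terms in [divsum 3] and [divsum 5] of [tau_formula] ([bdry]). *)
Lemma period_sum_coef_tau n : period_sum_coef n 1 = 4%:R * tau n.
Proof.
pose W (a u c v : int) := period_coef a (a - u) c (c + v) 1.
pose psi (a u c v : int) : int := 2%:R * (a ^+ 3 * (u ^+ 6 * c)) - 3%:R * (u ^+ 5 * (a ^+ 4 * v)).
pose Psi a u c v := psi a u c v + psi u a v c.
(* Found by linear algebra: solves [W = 280 Psi + H - shear H] *)
pose h (a u c v : int) : int := c * (- 36%:R * a ^+ 8 * u + 315%:R * a ^+ 6 * u ^+ 3
  + 420%:R * a ^+ 5 * u ^+ 4 - 280%:R * a ^+ 3 * u ^+ 6 - 135%:R * a ^+ 2 * u ^+ 7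
  + 4%:R * u ^+ 9).
pose H a u c v := h a u c v + h u a v c.
have WE a u c v : W a u c v - 280%:R * Psi a u c v = H a u c v - shear H a u c v.
  by rewrite /W period_coef1 /Psi /psi /shear /H /h; ring.
have symH : swap_sym H by move=> *; rewrite /H addrC.
have symPsi : swap_sym Psi by move=> *; rewrite /Psi addrC.
have lPsi : lsum n predT Psi = 2%:R * tau_conv n.
  rewrite /Psi lsumD -(@lsum_swap n predT predT psi) //.
  by rewrite -[lsum n predT psi]/(tau_conv n); ring.
have main : lsum n (fun q => q.2.1 < q.1.1)%N W *+ 2 =
   280%:R * (2%:R * tau_conv n - lsum n (fun q => q.1.1 == q.2.1) Psi)
   + lsum n (fun q => q.1.2 == q.2.2) H - lsum n (fun q => q.1.1 == q.2.1) H.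
  rewrite -lPsi -lsum_gt2 // -[RHS]addrA -liouville_identity // -lsumB -(lsum_eq _ _ WE) lsumB lsumZ.
  by ring.
have diag : 6%:R * lsum n (fun q => q.1.1 == q.2.1) W
   - 3%:R * lsum n (fun q => q.1.1 == q.2.1) H
   - 840%:R * lsum n (fun q => q.1.1 == q.2.1) Psi = 0.
  rewrite -!lsumZ -!lsumB /lsum big1 // => -[[a v] [u c]] /= /eqP ->.
  by rewrite /W period_coef1 /H /h /Psi /psi; ring.
have bdry : 3%:R * lsum n (fun q => q.1.2 == q.2.2) H +
   6%:R * \sum_(p <- factor_pairs n) \sum_(1 <= u < p.1.+1) W p.1%:Z u%:Z 0 p.2%:Z
   = 2%:R * (n%:Z * (5%:R * divsum 3 n + 7%:R * divsum 5 n)).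
  rewrite lsum_codiag !mulr_sumr -big_split /=.
  transitivity (\sum_(p <- factor_pairs n)
     (10%:R * n%:Z * p.1%:Z ^+ 3 + 14%:R * n%:Z * p.1%:Z ^+ 5)); last first.
    by rewrite /divsum big_split /= -!mulr_sumr; ring.
  apply: eq_big_seq => -[a m]; rewrite mem_factor_pairs /= => /and3P[a0 m0 /eqP <-].
  apply: (@mulfI _ 10%:R) => //.
  (* [G] and [K] are 30 times the antidifferences, in the summation variable, of the boundary values
     of [H] and [W], with the common factor m removed. *)
  pose G (x m : int) : int := 120%:R * x ^+ 9 * m - 120%:R * x ^+ 9 - 1080%:R * x ^+ 8 * m ^+ 2 + 1080%:R * x ^+ 8 * m +
    2970%:R * x ^+ 7 * m ^+ 3 - 4455%:R * x ^+ 7 * m ^+ 2 + 1485%:R * x ^+ 7 * m - 2730%:R * x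
    ^+ 6 * m ^+ 4 + 5460%:R * x ^+ 6 * m ^+ 3 - 2730%:R * x ^+ 6 * m ^+ 2 - 630%:R * x ^+ 5 * m
    ^+ 5 + 1575%:R * x ^+ 5 * m ^+ 4 - 1050%:R * x ^+ 5 * m ^+ 3 + 105%:R * x ^+ 5 * m + 2730%:R
    * x ^+ 4 * m ^+ 6 - 8190%:R * x ^+ 4 * m ^+ 5 + 6825%:R * x ^+ 4 * m ^+ 4 - 1365%:R * x ^+ 4
    * m ^+ 2 - 2220%:R * x ^+ 3 * m ^+ 7 + 7770%:R * x ^+ 3 * m ^+ 6 - 7770%:R * x ^+ 3 * m ^+ 5
    + 2590%:R * x ^+ 3 * m ^+ 3 - 370%:R * x ^+ 3 * m + 1080%:R * x ^+ 2 * m ^+ 8 - 4320%:R * x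
    ^+ 2 * m ^+ 7 + 5040%:R * x ^+ 2 * m ^+ 6 - 2520%:R * x ^+ 2 * m ^+ 4 + 720%:R * x ^+ 2 * m
    ^+ 2 - 240%:R * x * m ^+ 9 + 1080%:R * x * m ^+ 8 - 1440%:R * x * m ^+ 7 + 1008%:R * x * m
    ^+ 5 - 480%:R * x * m ^+ 3 + 72%:R * x * m.
  pose K (x m : int) : int := 1080%:R * x ^+ 8 * m ^+ 2 - 1080%:R * x ^+ 8 * m - 4320%:R * x ^+ 7 * m ^+ 3 + 6480%:R * x
    ^+ 7 * m ^+ 2 - 2160%:R * x ^+ 7 * m + 4830%:R * x ^+ 6 * m ^+ 4 - 9660%:R * x ^+ 6 * m ^+ 3
    + 4830%:R * x ^+ 6 * m ^+ 2 + 630%:R * x ^+ 5 * m ^+ 5 - 1575%:R * x ^+ 5 * m ^+ 4 + 1050%:R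
    * x ^+ 5 * m ^+ 3 - 105%:R * x ^+ 5 * m - 4830%:R * x ^+ 4 * m ^+ 6 + 14490%:R * x ^+ 4 * m
    ^+ 5 - 12075%:R * x ^+ 4 * m ^+ 4 + 2415%:R * x ^+ 4 * m ^+ 2 + 3570%:R * x ^+ 3 * m ^+ 7 -
    12495%:R * x ^+ 3 * m ^+ 6 + 12495%:R * x ^+ 3 * m ^+ 5 - 4165%:R * x ^+ 3 * m ^+ 3 + 595%:R
    * x ^+ 3 * m - 1080%:R * x ^+ 2 * m ^+ 8 + 4320%:R * x ^+ 2 * m ^+ 7 - 5040%:R * x ^+ 2 * m
    ^+ 6 + 2520%:R * x ^+ 2 * m ^+ 4 - 720%:R * x ^+ 2 * m ^+ 2 + 120%:R * x * m ^+ 9 - 540%:R *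
    x * m ^+ 8 + 720%:R * x * m ^+ 7 - 504%:R * x * m ^+ 5 + 240%:R * x * m ^+ 3 - 36%:R * x * m.
  have eG : 30%:R * \sum_(1 <= i < a) H i%:Z (a%:Z - i%:Z) m%:Z m%:Z = m%:Z * G a a.
    rewrite (@sum_telescope 30%:R (fun i => H i (a%:Z - i) m m) (fun i => m%:Z * G a i)) //.
      by rewrite /G; ring.
    by move=> i; rewrite /G /H /h; ring.
  have eK : 30%:R * \sum_(1 <= i < a) W a i%:Z 0 m%:Z = m%:Z * K a a.
    rewrite (@sum_telescope 30%:R (fun i => W a i 0 m) (fun i => m%:Z * K a i)) //.
      by rewrite /K; ring.
    by move=> i; rewrite /K /W period_coef1; ring.
  rewrite big_nat_recr //= mulrDr !mulrA.
  have -> : (10%:R : int) * 3%:R = 30%:R by [].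
  rewrite eG.
  transitivity (m%:Z * G a a + 2%:R * (30%:R * \sum_(1 <= i < a) W a i%:Z 0 m%:Z) + 60%:R * W a a 0 m).
    by ring.
  rewrite eK PoszM /W period_coef1 /G /K; ring.
apply: (@mulfI _ 6%:R) => //.
have -> : 6%:R * (4%:R * tau n) = 2%:R * (12%:R * tau n) by ring.
rewrite tau_formula period_sum_coef1E -/W mulrDr [in LHS]mulrDr.
rewrite mulr2n in main; lra.
Qed.

Lemma hecke_eigen_tau p k t : prime p -> hecke_eigen p k t -> tau (p ^ k) = t.
Proof.
move=> pp /(hecke_eigen_coef pp); rewrite period_sum_coef_tau.
by apply: mulfI.
Qed.

Theorem tau_hecke p k : prime p ->
  tau (p ^ k.+2) = tau p * tau (p ^ k.+1) - p%:Z ^+ 11 * tau (p ^ k).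
Proof.
move=> pp; have [t Et] := hecke_eigen_exists pp k; have [s Es] := hecke_eigen_exists pp k.+1.
have [t1 E1] := hecke_eigen1 pp; have E := hecke_eigenSS pp E1 Es Et.
rewrite (hecke_eigen_tau pp E) (hecke_eigen_tau pp Es) (hecke_eigen_tau pp Et).
by rewrite -[p in tau p]expn1 (hecke_eigen_tau pp E1).
Qed.

Lemma tau_square p : prime p -> tau (p ^ 2) = tau p ^+ 2 - p%:Z ^+ 11.
Proof. by move=> pp; rewrite tau_hecke // expn1 expn0 tau1 mulr1 expr2. Qed.

Lemma tau_cube p : prime p -> tau (p ^ 3) = tau p * (tau p ^+ 2 - 2%:R * p%:Z ^+ 11).
Proof. by move=> pp; rewrite tau_hecke // expn1 tau_square //; ring. Qed.

Lemma divsum_prime k p : prime p -> divsum k p = 1 + p%:Z ^+ k.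
Proof.
move=> pp; rewrite /divsum -[X in factor_pairs X]expn1.
rewrite (perm_big _ (factor_pairs_pfactor 1 pp)) /= !big_cons big_nil /=.
by rewrite expn0 expn1 expr1n addr0.
Qed.

(** * A congruence and a polynomial bound for tau *)

Lemma cube_mod3 (x : int) : exists k, x ^+ 3 = x + 3%:R * k.
Proof.
have [r [e rE]] : exists r e : int, (e = 0 \/ e = 1 \/ e = 2) /\ x = 3%:R * r + e.
  exists (x %/ 3)%Z, (x %% 3)%Z.
  have := divz_eq x 3; have := ltz_pmod x (isT : 0 < 3 :> int); have := modz_ge0 x (isT : 3 != 0 :> int).
  by move=> h1 h2 h3; split; lia.
exists (9%:R * r ^+ 3 + 9%:R * r ^+ 2 * e + 3%:R * r * e ^+ 2 - r + (if e == 2 then 2 else 0)).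
by case: rE => -[->|[->|->]] ->; rewrite /=; ring.
Qed.

Lemma dvdz_lsum n C F (m : int) : (forall a u c v, m %| F a u c v)%Z -> (m %| lsum n C F)%Z.
Proof. by move=> mF; apply: rpred_sum => q _; apply: mF. Qed.

(** Modulo 3 the summand is 2 a u^2 c because x^3 = x, and symmetrising it gives a u (a v + u c) = n
    a u. *)
Lemma tau_conv_mod3 n : exists z, tau_conv n = n%:Z * divconv 1 1 n + 3%:R * z.
Proof.
pose g (a u c v : int) : int := a * u * (u * c).
have -> : n%:Z * divconv 1 1 n = 2%:R * lsum n predT g.
  have -> : 2%:R * lsum n predT g = lsum n predT (fun a u c v => g a u c v + g u a v c).
    by rewrite lsumD -(@lsum_swap n predT predT g) //; ring.
  rewrite -lsum_divconv -lsumZ /lsum; apply: eq_big_seq => -[[a v] [u c]].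
  by rewrite mem_liouville /g /= => /and5P[_ _ _ _ /eqP <-]; rewrite PoszD !PoszM; ring.
suff /dvdzP[z e] : (3 %| tau_conv n - 2%:R * lsum n predT g)%Z.
  by exists z; rewrite -[LHS](subrK (2%:R * lsum n predT g)) e; ring.
rewrite /tau_conv -lsumZ -lsumB; apply: dvdz_lsum => a u c v.
have [k ak] := cube_mod3 a; have [l ul] := cube_mod3 u.
apply/dvdzP; exists (2%:R * c * (a * (2%:R * u * l + 3%:R * l ^+ 2) + k * (u + 3%:R * l) ^+ 2)
  - u ^+ 5 * (a ^+ 4 * v)).
have -> : u ^+ 6 = (u ^+ 3) ^+ 2 by ring.
by rewrite ak ul /g; ring.
Qed.

(** The right side of [tau_formula] is 6 modulo 9; as 840 = 70 * 12, [divconv11] evaluates its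
    convolution without division. *)
Lemma tau_neq0 p : prime p -> (p %% 3 = 1)%N -> tau p != 0.
Proof.
move=> pp p1; apply/eqP => t0; have := tau_formula p; rewrite t0 mulr0.
have [z ->] := tau_conv_mod3 p; have := divconv11 p; rewrite !divsum_prime // expr1.
move=> S11 e.
have pE : p%:Z = 3%:R * (p %/ 3)%N%:Z + 1 by have := divn_eq p 3; lia.
move: S11 e; rewrite pE; set k := (p %/ 3)%N%:Z => S11.
set S := divconv 1 1 p in S11 *.
have -> : 840%:R * ((3%:R * k + 1) * S + 3%:R * z) =
   70%:R * (3%:R * k + 1) * (12 * S) + 9%:R * (280%:R * z) by ring.
rewrite S11 => e.
have [q eq0] : exists q : int, 6%:R + 9%:R * q = 0; last by lia.
(* The quotient by 9 of the expansion in k, after removing the residue 6. *)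
exists (2%:R - 22%:R * k + 625%:R * k ^+ 2 + 3420%:R * k ^+ 3 + 4140%:R * k ^+ 4 +
   1134%:R * k ^+ 5 + 567%:R * k ^+ 6 + 280%:R * z).
by rewrite [RHS]e; ring.
Qed.

Lemma lsum_bound n F (B : int) :
  (forall a u c v : int, 0 <= a <= n%:Z -> 0 <= u <= n%:Z -> 0 <= c <= n%:Z -> 0 <= v <= n%:Z ->
    `|F a u c v| <= B) -> 0 <= B ->
  `|lsum n predT F| <= (n.+1 ^ 4)%N%:Z * B.
Proof.
move=> FB B0; apply: le_trans (ler_norm_sum _ _ _) _.
apply: (@le_trans _ _ (\sum_(q <- liouville n) B)).
  rewrite big_seq [leRHS]big_seq; apply: ler_sum => -[[a v] [u c]].
  rewrite mem_liouville => /and5P[a0 v0 u0 c0 /eqP e]; rewrite /= in a0 v0 u0 c0 e *.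
  by apply: FB; nia.
rewrite big_const_seq count_predT iter_addr_0 -mulr_natl natz ler_wpM2r // lez_nat.
rewrite size_filter (leq_trans (count_size _ _)) // !size_allpairs !size_iota.
by rewrite !mulnn -expnM.
Qed.

Lemma divsum_bound k n : 0 <= divsum k n <= (n.+1 ^ 2)%N%:Z * n%:Z ^+ k.
Proof.
apply/andP; split; first by apply: sumr_ge0 => q _; rewrite exprn_ge0.
apply: (@le_trans _ _ (\sum_(q <- factor_pairs n) n%:Z ^+ k)).
  rewrite /divsum big_seq [leRHS]big_seq; apply: ler_sum => -[a b]; rewrite mem_factor_pairs /= => /and3P[a0 b0 /eqP e].
  by rewrite lerXn2r // ?nnegrE // lez_nat; nia.
rewrite big_const_seq count_predT iter_addr_0 -mulr_natl natz ler_wpM2r ?exprn_ge0 // lez_nat.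
by rewrite size_filter (leq_trans (count_size _ _)) // size_allpairs !size_iota -mulnn.
Qed.

Lemma tau_bound n : (1 < n)%N -> `|tau n| <= n%:Z ^+ 27.
Proof.
move=> n1; set x := n%:Z; have x2 : 2 <= x by rewrite /x; lia.
have n1x : n.+1%:Z <= x ^+ 2 by rewrite /x expr2 -PoszM lez_nat; nia.
have powE k : (n.+1 ^ k)%N%:Z = n.+1%:Z ^+ k by rewrite -natz natrX natz.
have n1x4 : (n.+1 ^ 4)%N%:Z <= x ^+ 8.
  rewrite powE (_ : x ^+ 8 = (x ^+ 2) ^+ 4); last by ring.
  by rewrite lerXn2r ?nnegrE ?exprn_ge0.
have n1x2 : (n.+1 ^ 2)%N%:Z <= x ^+ 4.
  rewrite powE (_ : x ^+ 4 = (x ^+ 2) ^+ 2); last by ring.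
  by rewrite lerXn2r ?nnegrE ?exprn_ge0.
have x0 : 0 <= x by [].
have x1 : 1 <= x by lia.
have conv : `|tau_conv n| <= x ^+ 8 * (5%:R * x ^+ 10).
  apply: le_trans (lsum_bound (B := 5%:R * x ^+ 10) _ _) _; last 2 first.
  - by rewrite mulr_ge0 // exprn_ge0.
  - by rewrite ler_wpM2r // mulr_ge0 // exprn_ge0.
  move=> a u c v /andP[a0 ax] /andP[u0 ux] /andP[c0 cx] /andP[v0 vx].
  have h1 : 0 <= a ^+ 3 * (u ^+ 6 * c) <= x ^+ 10.
    rewrite !mulr_ge0 ?exprn_ge0 //= (_ : x ^+ 10 = x ^+ 3 * (x ^+ 6 * x)); last by ring.
    by rewrite !ler_pM ?lerXn2r ?nnegrE ?mulr_ge0 ?exprn_ge0.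
  have h2 : 0 <= u ^+ 5 * (a ^+ 4 * v) <= x ^+ 10.
    rewrite !mulr_ge0 ?exprn_ge0 //= (_ : x ^+ 10 = x ^+ 5 * (x ^+ 4 * x)); last by ring.
    by rewrite !ler_pM ?lerXn2r ?nnegrE ?mulr_ge0 ?exprn_ge0.
  by rewrite ler_norml; lia.
have s k : (k <= 5)%N -> 0 <= divsum k n <= x ^+ 9.
  move=> k5; have /andP[-> /= h] := divsum_bound k n; apply: le_trans h _.
  rewrite (_ : x ^+ 9 = x ^+ 4 * x ^+ 5); last by ring.
  by rewrite ler_pM ?exprn_ge0 // ler_weXn2l.
have /andP[s30 s3] := s 3%N isT; have /andP[s50 s5] := s 5%N isT.
have e := tau_formula n; rewrite -/x in e.
have x18 : x ^+ 8 * (5%:R * x ^+ 10) = 5%:R * x ^+ 18 by ring.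
have x10 : x * (5%:R * divsum 3 n + 7%:R * divsum 5 n) <= 12%:R * x ^+ 18.
  apply: (@le_trans _ _ (x * (12%:R * x ^+ 9))); first by rewrite ler_wpM2l //; lia.
  rewrite (_ : x * (12%:R * x ^+ 9) = 12%:R * x ^+ 10); last by ring.
  by rewrite ler_wpM2l // ler_weXn2l.
have x10' : 0 <= x * (5%:R * divsum 3 n + 7%:R * divsum 5 n) by rewrite mulr_ge0 //; lia.
(* 351 = (12 + 840 * 5) / 12, and 351 <= 2^9 <= x^9 below. *)
have key : `|tau n| <= 351%:R * x ^+ 18.
  by move: conv; rewrite x18 !ler_norml; lia.
apply: le_trans key _; rewrite (_ : x ^+ 27 = x ^+ 9 * x ^+ 18); last by ring.
rewrite ler_wpM2r ?exprn_ge0 //.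
by apply: (@le_trans _ _ (2 ^+ 9)) => //; rewrite lerXn2r.
Qed.

(** * Primes congruent to 1 modulo 3 *)

Section PrimesOneMod3.
Local Open Scope nat_scope.

(** The value of the cyclotomic polynomial x^2 + x + 1 at x = 3 k; the factor 3 keeps the prime 3
    from dividing it. *)
Definition quad k := 9 * k ^ 2 + 3 * k + 1.

Lemma quad_gt0 k : 0 < quad k.
Proof. by rewrite /quad addn1. Qed.

Lemma leq_quad k N : k <= N -> quad k <= quad N.
Proof. by rewrite /quad; nia. Qed.

Lemma quad_leq_cube N : 13 <= N -> quad N <= N ^ 3.
Proof. by rewrite /quad !expnS expn0; nia. Qed.

(** The residue x of 3 k satisfies x^3 = 1. If p = 2 mod 3, then x = x^p = x^2, and x^2 + x + 1 = 0
    forces 3 = 0 in F_p. *)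
Lemma prime_dvd_quad p k : prime p -> p %| quad k -> p %% 3 = 1.
Proof.
move=> pp pk; have p3 : p != 3.
  apply: contraTneq pk => ->; rewrite /quad dvdn_addr; first by [].
  by rewrite dvdn_add // dvdn_mulr.
have : p %% 3 < 3 by rewrite ltn_mod.
case e : (p %% 3) => [|[|[|//]]] // _.
  have : 3 %| p by rewrite /dvdn e.
  by rewrite dvdn_prime2 // eq_sym (negPf p3).
pose x : 'F_p := (3 * k)%:R%R.
have x0 : (x ^+ 2 + x + 1 = 0)%R.
  apply/eqP; rewrite /x -natrX -natrD -(natrD _ _ 1) -(dvdn_pcharf (pchar_Fp pp)).
  by move: pk; rewrite /quad expnMn.
have x3 : (x ^+ 3 = 1)%R.
  apply/eqP; rewrite -subr_eq0; apply/eqP.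
  by transitivity ((x - 1) * (x ^+ 2 + x + 1))%R; [ring|rewrite x0 mulr0].
have xp : (x ^+ p = x)%R.
  by rewrite -(pFrobenius_autE (pchar_Fp pp)) pFrobenius_aut_nat.
have x2 : (x ^+ 2 = x)%R.
  have pe : p = 3 * (p %/ 3) + 2 by rewrite {1}(divn_eq p 3) e mulnC.
  have xE n : n = p -> (x ^+ n = x)%R by move=> ->.
  by rewrite -[RHS](xE _ (esym pe)) exprD exprM x3 expr1n mul1r.
have : (3%:R == 0 :> 'F_p)%R.
  (* This is 3 = 4 (x^2 + x + 1) - (2 x + 1)^2, with 2 x + 1 expressed by the two relations. *)
  apply/eqP; transitivity (4%:R * (x ^+ 2 + x + 1) - (x ^+ 2 + x + 1 - (x ^+ 2 - x)) ^+ 2)%R; first by ring.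
  by rewrite x0 x2 subrr; ring.
by rewrite -(dvdn_pcharf (pchar_Fp pp)) dvdn_prime2 // (negPf p3).
Qed.

Lemma size_congruent (s : seq nat) N q : 0 < q -> uniq s ->
  (forall k, k \in s -> k <= N) ->
  (forall k l, k \in s -> l \in s -> k = l %[mod q]) -> size s <= N %/ q + 1.
Proof.
move=> q0 us sN sq; rewrite -(size_map (fun k => k %/ q)) -[X in _ <= X](size_iota 0).
apply: uniq_leq_size.
  rewrite map_inj_in_uniq // => k l ks ls e.
  by rewrite (divn_eq k q) (divn_eq l q) e (sq _ _ ks ls).
by move=> _ /mapP[k ks ->]; rewrite mem_iota addn1 ltnS /= leq_div2r // sN.
Qed.

(** At most two residue classes modulo p^j occur: quad k - quad k0 = 3 (k - k0) w(k), and p cannot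
    divide both factors, as it would then divide 4 quad k0 - (6 k0 + 1)^2 = 3. So p^j divides one of
    them. *)
Lemma count_quad p j N : prime p -> p != 3 ->
  count (fun k => p ^ j %| quad k) (index_iota 1 N.+1) <= 2 * (N %/ p ^ j + 1).
Proof.
move=> pp p3; rewrite -size_filter; set B := [seq k <- _ | _].
have uB : uniq B by rewrite filter_uniq ?iota_uniq.
have BN k : k \in B -> k <= N.
  by rewrite mem_filter mem_index_iota ltnS => /and3P[].
have Bq k : k \in B -> p ^ j %| quad k by rewrite mem_filter => /andP[].
have q0 : 0 < p ^ j by rewrite expn_gt0 prime_gt0.
case: (posnP (size B)) => [->//|B0].
pose k0 := nth 0 B 0; have k0B : k0 \in B by rewrite mem_nth.
have cop3 : coprime (p ^ j) 3 by rewrite coprimeXl // prime_coprime // dvdn_prime2.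
rewrite -(count_predC (fun k => k == k0 %[mod p ^ j])) mul2n -addnn.
pose w k : int := (3%:R * (k%:Z + k0%:Z) + 1)%R.
have key k : k \in B -> k != k0 %[mod p ^ j] -> ((p ^ j)%N%:Z %| w k)%Z.
  move=> kB kk0; have j0 : 0 < j by case: (j) kk0 => //; rewrite expn0 !modn1.
  have quadE m : (quad m)%:Z = (9%:R * m%:Z ^+ 2 + 3%:R * m%:Z + 1)%R.
    by rewrite /quad !PoszD !PoszM; ring.
  have : ((p ^ j)%N%:Z %| (3%:R * ((k%:Z - k0%:Z) * w k))%R)%Z.
    have -> : (3%:R * ((k%:Z - k0%:Z) * w k) = (quad k)%:Z - (quad k0)%:Z)%R.
      by rewrite !quadE /w; ring.
    by rewrite rpredB // dvdzE /= Bq.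
  rewrite Gauss_dvdzr //.
  have [pu|pu] := boolP (p %| `|(k%:Z - k0%:Z)%R|).
    have pw : ~~ (p %| `|w k|).
      apply/negP => pw; have : (p%:Z %| (3%:R)%R)%Z.
        have -> : (3%:R = 4%:R * (quad k0)%:Z - (w k - 3%:R * (k%:Z - k0%:Z)) ^+ 2)%R.
          by rewrite quadE /w; ring.
        rewrite rpredB // ?dvdz_mull //.
          by rewrite dvdzE /= (dvdn_trans _ (Bq _ k0B)) // dvdn_exp.
        by rewrite rpredB ?dvdz_mull // dvdzE.
      by rewrite dvdzE /= dvdn_prime2 // (negPf p3).
    rewrite Gauss_dvdzl; last by rewrite coprimezE /= coprimeXl // prime_coprime.
    by rewrite -eqz_mod_dvd !modz_nat eqz_nat (negPf kk0).
  rewrite Gauss_dvdzr //.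
  by rewrite coprimezE /= coprimeXl // prime_coprime.
rewrite leq_add // -size_filter; apply: size_congruent; rewrite ?(filter_uniq _ uB) //.
- by move=> k; rewrite mem_filter => /andP[_ /BN].
- by move=> k l; rewrite !mem_filter => /andP[/eqP-> _] /andP[/eqP-> _].
- by move=> k; rewrite mem_filter => /andP[_ /BN].
move=> k l; rewrite mem_filter => /andP[kk0 kB]; rewrite mem_filter => /andP[lk0 lB].
have : ((p ^ j)%N%:Z %| (w k - w l)%R)%Z.
  have /dvdzP[x ex] := key _ kB kk0; have /dvdzP[y ey] := key _ lB lk0.
  by apply/dvdzP; exists (x - y)%R; rewrite ex ey mulrBl.
have -> : (w k - w l = 3%:R * (k%:Z - l%:Z))%R by rewrite /w; ring.
by rewrite Gauss_dvdzr // -eqz_mod_dvd !modz_nat eqz_nat => /eqP.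
Qed.

Lemma sum_divn_pow p N J : 1 < p -> (\sum_(1 <= j < J.+1) N %/ p ^ j) * p.-1 <= N.
Proof.
move=> p1; elim: J N => [|J IH] N; first by rewrite big_geq.
rewrite big_nat_recl // expn1.
have -> : \sum_(1 <= j < J.+1) N %/ p ^ j.+1 = \sum_(1 <= j < J.+1) (N %/ p) %/ p ^ j.
  by apply: eq_bigr => j _; rewrite expnS divnMA.
rewrite mulnDl; apply: leq_trans (leq_add (leqnn _) (IH _)) _.
rewrite -mulnSr prednK ?(ltnW p1) // mulnC.
by rewrite mulnC leq_trunc_div.
Qed.

Lemma logn_le_count p m J : prime p -> 0 < m -> m < p ^ J.+1 ->
  logn p m <= \sum_(1 <= j < J.+1) (p ^ j %| m).
Proof.
move=> pp m0 mJ; have LJ : logn p m <= J.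
  rewrite -ltnS -(ltn_exp2l _ _ (prime_gt1 pp)); apply: leq_ltn_trans mJ.
  by rewrite dvdn_leq // pfactor_dvdnn.
rewrite (@big_cat_nat _ _ _ (logn p m).+1) //=.
rewrite [X in _ <= X + _](_ : _ = logn p m) ?leq_addr //.
rewrite big_nat; under eq_bigr => j /andP[_ jL] do rewrite pfactor_dvdn // -ltnS jL.
by rewrite -big_nat sum_nat_const_nat muln1 subn1.
Qed.

Lemma logn_prod_quad p N J : prime p -> p != 3 -> quad N < p ^ J.+1 ->
  logn p (\prod_(1 <= k < N.+1) quad k) <= 2 * (\sum_(1 <= j < J.+1) N %/ p ^ j) + 2 * J.
Proof.
move=> pp p3 NJ.
have -> : logn p (\prod_(1 <= k < N.+1) quad k) = \sum_(1 <= k < N.+1) logn p (quad k).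
  elim: (N) => [|n IH]; first by rewrite !big_geq // logn1.
  rewrite !(@big_nat_recr _ _ _ n.+1) //= lognM ?IH ?quad_gt0 //.
  by rewrite prodn_gt0 // => k; exact: quad_gt0.
apply: (@leq_trans (\sum_(1 <= k < N.+1) \sum_(1 <= j < J.+1) (p ^ j %| quad k))).
  rewrite big_nat [X in _ <= X]big_nat; apply: leq_sum => k /andP[_ kN].
  apply: logn_le_count; rewrite ?quad_gt0 //.
  by apply: leq_ltn_trans NJ; apply: leq_quad.
rewrite exchange_big_nat /=.
apply: (@leq_trans (\sum_(1 <= j < J.+1) 2 * (N %/ p ^ j + 1))).
  apply: leq_sum => j _; apply: leq_trans (count_quad j N pp p3).
  by rewrite -sum1_count [X in _ <= X]big_mkcond /=; apply: leq_sum => k _; case: (_ %| _).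
by rewrite -big_distrr /= big_split /= sum_nat_const_nat muln1 subn1 mulnDr.
Qed.

Lemma fact_leq_exp z : z`! <= z ^ z.
Proof.
rewrite fact_prod (_ : z ^ z = \prod_(1 <= i < z.+1) z); last first.
  by rewrite prod_nat_const_nat subn1.
by rewrite big_nat [X in _ <= X]big_nat; apply: leq_prod => i /andP[_ iz].
Qed.

Lemma prod_primes m : 0 < m -> m = \prod_(p <- primes m) p ^ logn p m.
Proof. by move=> m0; rewrite {1}(prod_prime_decomp m0) prime_decompE big_map. Qed.

Lemma prod_pow_divn_dvd_fact z (s : seq nat) : uniq s -> all prime s ->
  \prod_(p <- s) p ^ (z %/ p) %| z`!.
Proof.
elim: s => [|p s IH] /=; first by rewrite big_nil dvd1n.
move=> /andP[ps us] /andP[pp sp]; rewrite big_cons Gauss_dvd ?IH // ?andbT.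
  rewrite pfactor_dvdn ?fact_gt0 // logn_fact //.
  case: (z) => [|z']; first by rewrite div0n.
  by rewrite big_ltn // expn1 leq_addr.
rewrite big_seq; elim/big_ind: _ => [|x y cx cy|q qs]; first exact: coprimen1.
  by rewrite coprimeMr cx.
rewrite coprimeXl // coprimeXr // prime_coprime // dvdn_prime2 //; last exact: (allP sp).
by apply: contraNneq ps => ->.
Qed.

(** Each factor in the upper half is at least N^2, since 9 k^2 >= 9 N^2 / 4. *)
Lemma prod_quad_lower N : N ^ N <= \prod_(1 <= k < N.+1) quad k.
Proof.
have hN : N %/ 2 <= N by rewrite leq_div.
rewrite (@big_cat_nat _ _ _ (N %/ 2).+1) //=.
apply: (@leq_trans (1 * \prod_((N %/ 2).+1 <= k < N.+1) N ^ 2)).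
  rewrite mul1n prod_nat_const_nat -expnM subSS.
  case: (posnP N) => [->//|N0]; rewrite leq_pexp2l //.
  by have := divn_eq N 2; lia.
apply: leq_mul; first by rewrite prodn_gt0 // => k; exact: quad_gt0.
rewrite big_nat [X in _ <= X]big_nat; apply: leq_prod => k /andP[hk _].
have : N <= 2 * k by have := divn_eq N 2; have := ltn_pmod N (isT : 0 < 2); lia.
rewrite /quad; nia.
Qed.

(** The first factor is shaped so that its product over p divides a power of z!, which takes the
    place of an estimate for the sum of (log p) / p. It covers p <= z, where z / p is at most twice
    its integer part; for p > z the exponent 4 N / p is below 4 w. The remaining two powers of quad
    N bound p^(2 J). *)
Lemma pfactor_prod_quad p N z w : prime p -> p %% 3 = 1 -> p <= quad N ->
  N = z * w -> 0 < z ->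
  p ^ logn p (\prod_(1 <= k < N.+1) quad k) <= (p ^ (z %/ p)) ^ (8 * w) * quad N ^ (4 * w + 2).
Proof.
move=> pp pmod pN Nzw z0; have p1 := prime_gt1 pp; have p0 := prime_gt0 pp.
have p3 : p != 3 by apply: contra_eqN pmod => /eqP->.
have /andP[J1 J2] := trunc_log_bounds p1 (quad_gt0 N); set J := trunc_log _ _ in J1 J2.
have := logn_prod_quad pp p3 J2; have := sum_divn_pow N J p1.
set g := \sum_(_ <= _ < _) _ => gN logA.
apply: (@leq_trans (p ^ (2 * g + 2 * J))); first by rewrite leq_pexp2l.
have pg : p * g <= 2 * N by nia.
rewrite (expnD p (2 * g)) (expnD (quad N) (4 * w)) mulnA leq_mul //.
  2: by rewrite (mulnC 2 J) expnM leq_exp2r.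
have [pz|zp] := leqP p z.
  rewrite -[X in X <= _]muln1 leq_mul ?expn_gt0 ?quad_gt0 //.
  rewrite -expnM leq_pexp2l //.
  have := divn_eq z p; have := ltn_pmod z p0.
  have : 0 < z %/ p by rewrite divn_gt0.
  set e := z %/ p => e0 r1 zE.
  have : z <= 2 * (p * e) by nia.
  move=> ze; rewrite -(leq_pmul2l p0); nia.
rewrite divn_small // expn0 exp1n mul1n.
apply: (@leq_trans (p ^ (4 * w))); last first.
  by case: (posnP w) => [->|w0]; rewrite ?muln0 // leq_exp2r // muln_gt0.
rewrite leq_pexp2l //; nia.
Qed.

(** With at most M such primes, the bounds on the product give M^(18 N) <= M^(16 N + 324 M^17) for N
    = M^18, false once 2 M > 324. The saving of 2 N is due to z = M^2, as (z^z)^(8 w) = z^(8 N) =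
    M^(16 N); and 54 comes from quad N <= N^3. *)
Lemma many_primes_1mod3 M : 162 < M ->
  M < size [seq p <- iota 0 (M ^ 54).+1 | prime p && (p %% 3 == 1)].
Proof.
move=> M162; set T := [seq p <- _ | _]; rewrite ltnNge; apply/negP => TM.
have M0 : 0 < M by lia.
pose z := M ^ 2; pose w := M ^ 16; pose N := M ^ 18.
have Nzw : N = z * w by rewrite /N /z /w -expnD.
have z0 : 0 < z by rewrite expn_gt0 M0.
have quadN : quad N <= N ^ 3.
  apply: quad_leq_cube; rewrite (leq_trans _ (leq_pexp2l M0 (isT : 1 <= 18))) // expn1.
  exact: leq_trans M162.
pose A := \prod_(1 <= k < N.+1) quad k.
have A0 : 0 < A by rewrite prodn_gt0 // => k; exact: quad_gt0.
have primesA p : p \in primes A -> [/\ prime p, p %% 3 = 1 & p <= quad N].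
  rewrite mem_primes => /and3P[pp _ pA].
  have [k kN pk] : exists2 k, k <= N & p %| quad k.
    move: pA; rewrite /A; elim: (N) => [|n IH]; first by rewrite big_geq // Euclid_dvd1.
    rewrite big_nat_recr //= Euclid_dvdM // => /orP[/IH[k kn pk]|pk].
      by exists k => //; apply: leqW.
    by exists n.+1.
  split=> //; first exact: prime_dvd_quad pk.
  by rewrite (leq_trans (dvdn_leq (quad_gt0 k) pk)) // leq_quad.
have tM : size (primes A) <= M.
  apply: leq_trans TM; apply: uniq_leq_size; first exact: primes_uniq.
  move=> p /primesA[pp p1 pN]; rewrite mem_filter pp p1 eqxx mem_iota add0n ltnS.
  by rewrite (leq_trans pN) // (leq_trans quadN) // /N -expnM.
have upper : A <= (z ^ z) ^ (8 * w) * (quad N ^ (4 * w + 2)) ^ M.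
  apply: (@leq_trans (\prod_(p <- primes A) ((p ^ (z %/ p)) ^ (8 * w) * quad N ^ (4 * w + 2)))).
    rewrite {1}(prod_primes A0) big_seq [X in _ <= X]big_seq.
    by apply: leq_prod => p /primesA[pp p1 pN]; apply: pfactor_prod_quad.
  rewrite big_split /= leq_mul //.
    rewrite -(big_morph (expn^~ (8 * w)) (fun a b => expnMn a b _) (exp1n _)) leq_exp2r ?muln_gt0 ?expn_gt0 ?M0 //.
    have := prod_pow_divn_dvd_fact z (primes_uniq A).
    have -> : all prime (primes A) by apply/allP => p /primesA[].
    move=> /(_ isT) /(dvdn_leq (fact_gt0 _)) h; apply: leq_trans h _.
    exact: fact_leq_exp.
  rewrite big_const_seq count_predT iter_muln_1 leq_pexp2l // expn_gt0 quad_gt0 //.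
have := leq_trans (prod_quad_lower N) upper.
apply/negP; rewrite -ltnNge.
apply: (@leq_ltn_trans (M ^ (16 * N + 324 * M ^ 17))).
  rewrite (expnD M (16 * N)) leq_mul //.
    by rewrite -!expnM leq_pexp2l // Nzw; lia.
  apply: (@leq_trans ((N ^ 3) ^ ((4 * w + 2) * M))).
    by rewrite -expnM leq_exp2r // muln_gt0 addn_gt0 orbT.
  rewrite /N -!expnM leq_pexp2l // /w (expnSr M 16).
  have : 0 < M ^ 16 by rewrite expn_gt0 M0.
  by set v := M ^ 16; nia.
have NE : N = M * M ^ 17 by rewrite /N expnS.
have -> : N ^ N = M ^ (18 * N) by rewrite {1}/N -expnM.
rewrite ltn_exp2l; last by rewrite (leq_trans _ M162).
rewrite NE; clear -M162 M0.
have : 0 < M ^ 17 by rewrite expn_gt0 M0.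
by set v := M ^ 17; nia.
Qed.

End PrimesOneMod3.

(** * Non-vanishing at squares and cubes of primes *)

Lemma sqr_neq_odd_pow (t : int) p k : prime p -> t ^+ 2 != p%:Z ^+ k.*2.+1.
Proof.
move=> pp; apply/eqP => /(congr1 absz); rewrite !abszX /= => /(congr1 (logn p)).
by rewrite pfactorK // lognX; lia.
Qed.

Lemma tau_square_neq0 p : prime p -> tau (p ^ 2) != 0.
Proof. by move=> pp; rewrite tau_square // subr_eq0 (@sqr_neq_odd_pow _ p 5). Qed.

Lemma tau2 : tau 2 = - 24%:R.
Proof.
apply: (@mulfI _ 12%:R) => //; rewrite tau_formula !divsum_prime //.
by rewrite /tau_conv /lsum (_ : liouville 2 = [:: ((1, 1), (1, 1))%N]) // big_seq1.
Qed.

(** For odd p the valuation of 2 p^11 at p is odd, so it is no square. *)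
Lemma tau_cube_neq0 p : prime p -> tau p != 0 -> tau (p ^ 3) != 0.
Proof.
move=> pp t0; rewrite tau_cube // mulf_neq0 // subr_eq0.
(* Here 2 * 2^11 = 64^2 is a square, and the value tau(2) = -24 is needed. *)
have [->|p2] := eqVneq p 2%N; first by rewrite tau2.
have p_2 : logn p 2 = 0%N by rewrite lognE dvdn_prime2 // (negPf p2) !andbF.
apply/eqP => /(congr1 absz); rewrite abszM !abszX => /(congr1 (logn p)).
rewrite lognX lognM ?expn_gt0 ?prime_gt0 // [`|2%:R|%N]/= p_2 pfactorK //.
by set l := logn p _; lia.
Qed.

(** * Smooth numbers *)

Definition smooth (S : seq nat) H := [seq n <- index_iota 1 H.+1 | all (mem S) (primes n)].

Lemma mem_smooth S H n : (n \in smooth S H) = [&& 0 < n, n <= H & all (mem S) (primes n)]%N.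
Proof. by rewrite mem_filter mem_index_iota ltnS andbC andbA. Qed.

Lemma smooth_uniq S H : uniq (smooth S H).
Proof. by rewrite filter_uniq ?iota_uniq. Qed.

Lemma size_smooth_cons q S H : prime q ->
  (size (smooth (q :: S) H) <= size (smooth S H) + size (smooth (q :: S) (H %/ q)))%N.
Proof.
move=> qp; have q0 := prime_gt0 qp.
rewrite -(size_map (muln q) (smooth _ (H %/ q))) -size_cat; apply: uniq_leq_size.
  exact: smooth_uniq.
move=> n; rewrite mem_smooth mem_cat => /and3P[n0 nH /allP nS].
have [/dvdnP[m nE]|qn] := boolP (q %| n)%N.
  apply/orP; right; apply/mapP; exists m; last by rewrite nE mulnC.
  have m0 : (0 < m)%N by move: n0; rewrite nE muln_gt0 => /andP[].
  rewrite mem_smooth m0 leq_divRL // -nE nH /=; apply/allP => r rm.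
  by apply: nS; rewrite nE primesM // rm.
apply/orP; left; rewrite mem_smooth n0 nH /=; apply/allP => r rn.
have := nS _ rn; rewrite !inE => /orP[/eqP rq|//].
by move: rn qn; rewrite rq mem_primes => /and3P[_ _ ->].
Qed.

Section SmoothCount.
Variable R : realType.

Definition euler_weight (d : R) (q : nat) : R := (q%:R `^ d)^-1.

Lemma euler_weight_lt1 d q : 0 < d -> prime q -> 0 < euler_weight d q < 1.
Proof.
move=> d0 qp; have q1 : 1 < q%:R :> R by rewrite ltr1n prime_gt1.
have q0 : 0 < q%:R :> R by rewrite (lt_trans _ q1).
rewrite /euler_weight invr_gt0 powR_gt0 //= invf_lt1 ?powR_gt0 //.
by rewrite -[X in X < _](congr1 (fun f => f d) (powR1 R)) gt0_ltr_powR ?nnegrE // ltW.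
Qed.

(* Rankin's trick. *)
Lemma size_smooth_rankin d S H : 0 < d -> all prime S ->
  (size (smooth S H))%:R <= H%:R `^ d * \prod_(q <- S) (1 - euler_weight d q)^-1.
Proof.
move=> d0; elim: S H => [|q S IH] H /=.
  move=> _; rewrite big_nil mulr1; have sz : (size (smooth [::] H) <= 1)%N.
    apply: (@uniq_leq_size _ (smooth [::] H) [:: 1%N]); first exact: smooth_uniq.
    move=> n; rewrite mem_smooth inE => /and3P[n0 _ /allP nS].
    rewrite eqn_leq n0 andbT leqNgt; apply/negP => n1.
    by have := nS (pdiv n); rewrite mem_primes pdiv_prime // n0 pdiv_dvd => /(_ isT).
  case: H sz => [|H] sz; first by rewrite powR_ge0.
  apply: (@le_trans _ _ 1); first by rewrite lern1.
  by rewrite -[leLHS](powRr0 H.+1%:R) ler_powR ?ler1n // ltW.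
move=> /andP[qp Sp]; have /andP[c0 c1] := euler_weight_lt1 d0 qp.
set c := euler_weight d q in c0 c1 *.
have c1' : 0 < 1 - c by rewrite subr_gt0.
have q0 : (0 < q)%N := prime_gt0 qp.
have P0 : 0 <= \prod_(r <- S) (1 - euler_weight d r)^-1.
  rewrite big_seq; apply: prodr_ge0 => r rS; rewrite invr_ge0 subr_ge0.
  by have /andP[_ /ltW] := euler_weight_lt1 d0 (allP Sp _ rS).
rewrite big_cons -/c; set P := \prod_(r <- S) _ in P0 IH *.
elim/ltn_ind: H => H IHH.
have [->|H0] := posnP H; first by rewrite mulr_ge0 ?powR_ge0 // mulr_ge0 // invr_ge0 ltW.
(* The recursion from H to H / q stands for the geometric series in c = q^(-d), through 1 + c / (1 -
   c) = 1 / (1 - c). *)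
apply: (@le_trans _ _ (H%:R `^ d * P + (H %/ q)%:R `^ d * ((1 - c)^-1 * P))).
  apply: le_trans (lerD (IH H Sp) (IHH (H %/ q)%N _)); last by rewrite ltn_Pdiv // prime_gt1.
  by rewrite -natrD ler_nat size_smooth_cons.
have Hq : (H %/ q)%:R `^ d <= H%:R `^ d * c.
  rewrite /c /euler_weight ler_pdivlMr ?powR_gt0 ?ltr0n // -powRM // -natrM.
  by rewrite ge0_ler_powR ?nnegrE ?ler_nat ?leq_trunc_div // ltW.
apply: (@le_trans _ _ (H%:R `^ d * P + H%:R `^ d * c * ((1 - c)^-1 * P))).
  by rewrite lerD2l ler_wpM2r // mulr_ge0 // invr_ge0 ltW.
rewrite le_eqVlt; apply/orP; left; apply/eqP; field.
by rewrite gt_eqF.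
Qed.

Lemma prod_euler_weight d k : 0 < d -> 0 < k -> exists2 C : R, 0 < C &
  forall S, uniq S -> all prime S ->
    \prod_(q <- S) (1 - euler_weight d q)^-1 <= C * expR (k * (size S)%:R).
Proof.
move=> d0 k0; pose e := 1 - expR (- k) : R.
have e0 : 0 < e by rewrite subr_gt0 -expR0 ltr_expR oppr_lt0.
pose q0 := (Num.truncn (e^-1 `^ d^-1)).+1.
have far q : (q0 <= q)%N -> prime q -> (1 - euler_weight d q)^-1 <= expR k.
  move=> q0q qp; have /andP[c0 c1] := euler_weight_lt1 d0 qp.
  rewrite -[expR k]invrK lef_pV2 ?posrE ?subr_gt0 ?invr_gt0 ?expR_gt0 // -expRN.
  rewrite lerBrDr addrC -lerBrDr -/e /euler_weight -[e]invrK lef_pV2 ?posrE ?powR_gt0 ?invr_gt0 ?ltr0n ?prime_gt0 //.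
  have -> : e^-1 = (e^-1 `^ d^-1) `^ d by rewrite -powRrM mulVf ?gt_eqF // powRr1 // invr_ge0 ltW.
  rewrite ge0_ler_powR ?nnegrE ?powR_ge0 ?(ltW d0) //.
  by apply: ltW; apply: lt_le_trans (truncnS_gt _) _; rewrite ler_nat.
pose F := (1 - euler_weight d 2)^-1.
have factor_le q : prime q -> 1 <= (1 - euler_weight d q)^-1 <= F.
  move=> qp; have /andP[c0 c1] := euler_weight_lt1 d0 qp.
  have /andP[f0 f1] := euler_weight_lt1 d0 (isT : prime 2).
  rewrite invf_ge1 ?subr_gt0 // lerBlDr lerDl ltW //=.
  rewrite lef_pV2 ?posrE ?subr_gt0 // lerD2l lerN2 lef_pV2 ?posrE ?powR_gt0 ?ltr0n ?prime_gt0 //.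
  by rewrite ge0_ler_powR ?nnegrE ?ler_nat ?prime_gt1 // ltW.
have F1 : 1 <= F by have /andP[h1 h2] := factor_le 2%N isT; apply: le_trans h1 h2.
exists (F ^+ q0); first by rewrite exprn_gt0 // (lt_le_trans _ F1).
move=> S uS pS; rewrite (bigID (fun q => q < q0)%N) /=; apply: ler_pM.
- rewrite big_seq_cond; apply: prodr_ge0 => q /andP[qS _].
  by have /andP[h _] := factor_le q (allP pS _ qS); apply: le_trans h.
- rewrite big_seq_cond; apply: prodr_ge0 => q /andP[qS _].
  by have /andP[h _] := factor_le q (allP pS _ qS); apply: le_trans h.
- apply: (@le_trans _ _ (\prod_(q <- S | (q < q0)%N) F)).
    rewrite [leLHS]big_seq_cond [leRHS]big_seq_cond; apply: ler_prod => q /andP[qS _].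
    have /andP[h ->] := factor_le q (allP pS _ qS).
    by rewrite (le_trans _ h).
  rewrite -big_filter big_const_seq count_predT iter_mulr_1 ler_weXn2l //.
  rewrite -[X in (_ <= X)%N](size_iota 0); apply: uniq_leq_size; first exact: filter_uniq.
  by move=> q; rewrite mem_filter mem_iota => /andP[].
- apply: (@le_trans _ _ (\prod_(q <- S | ~~ (q < q0)%N) expR k)).
    rewrite [leLHS]big_seq_cond [leRHS]big_seq_cond; apply: ler_prod => q /andP[qS].
    rewrite -leqNgt => q0q; have /andP[h _] := factor_le q (allP pS _ qS).
    by rewrite (le_trans _ h) //= far // (allP pS).
  rewrite -big_filter big_const_seq count_predT iter_mulr_1 expRM_natr ler_weXn2l //.
    by rewrite -expR0 ler_expR ltW.
  by rewrite size_filter count_size.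
Qed.

Lemma size_smooth_bound d k : 0 < d -> 0 < k -> exists2 C : R, 0 < C &
  forall S H, uniq S -> all prime S ->
    (size (smooth S H))%:R <= C * H%:R `^ d * expR (k * (size S)%:R).
Proof.
move=> d0 k0; have [C C0 CP] := prod_euler_weight d0 k0; exists C => // S H uS pS.
apply: le_trans (size_smooth_rankin H d0 pS) _.
by rewrite (mulrC C) -mulrA ler_wpM2l ?powR_ge0 // CP.
Qed.

End SmoothCount.

(** * Smooth pairs and the lower bound for omega *)

Definition primes_1mod3 m := [seq p <- iota 0 m.+1 | prime p && (p %% 3 == 1)%N].

(** By p^11 = tau(p)^2 - tau(p^2) the two absolute values and the sign of tau(p^2) determine p; the
    doubling accounts for that sign. The exponent 54 bounds tau(p^2) by (p^2)^27. *)
Lemma size_primes_1mod3_smooth m S :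
  (forall p, p \in primes_1mod3 m ->
     all (mem S) (primes `|tau p|%N) /\ all (mem S) (primes `|tau (p ^ 2)|%N)) ->
  (size (primes_1mod3 m) <= size (smooth S (m ^ 54)) * (size (smooth S (m ^ 54))).*2)%N.
Proof.
move=> TS; set T := primes_1mod3 m in TS *; set L := smooth S _.
pose phi p := (`|tau p|%N, (`|tau (p ^ 2)|%N, tau (p ^ 2) < 0)).
have phiE p : prime p -> p%:Z ^+ 11 =
    (phi p).1%:Z ^+ 2 - (if (phi p).2.2 then - (phi p).2.1%:Z else (phi p).2.1%:Z).
  move=> pp; rewrite /phi /= -[LHS](addrK (tau (p ^ 2))).
  have -> : (if tau (p ^ 2) < 0 then - `|tau (p ^ 2)|%N%:Z else `|tau (p ^ 2)|%N%:Z) = tau (p ^ 2).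
    by case: ltP => h; lia.
  by congr (_ - _); rewrite tau_square // addrC subrK abszE real_normK ?num_real.
have Tp p : p \in T -> [/\ prime p, (p %% 3 = 1)%N & (p <= m)%N].
  by rewrite mem_filter mem_iota add0n ltnS => /andP[/andP[pp /eqP p3] pm]; split.
have pow_le p k : (p <= m)%N -> (0 < p)%N -> (k <= 54)%N -> (p ^ k <= m ^ 54)%N.
  by move=> pm p0 k54; apply: leq_trans (leq_pexp2l p0 k54) _; rewrite leq_exp2r.
have absz_le (t : int) (n k : nat) : `|t| <= n%:Z ^+ k -> (`|t| <= n ^ k)%N.
  by rewrite -abszE -lez_nat; rewrite -[(n ^ k)%N%:Z]natz natrX natz.
have TL p : p \in T -> `|tau p|%N \in L /\ `|tau (p ^ 2)|%N \in L.
  move=> pT; have [pp p3 pm] := Tp _ pT; have [S1 S2] := TS _ pT; have p0 := prime_gt0 pp.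
  rewrite !mem_smooth S1 S2 !absz_gt0 tau_neq0 // tau_square_neq0 // !andbT /=; split.
    apply: (@leq_trans (p ^ 27)%N); last exact: pow_le.
    exact/absz_le/tau_bound/prime_gt1.
  apply: (@leq_trans ((p ^ 2) ^ 27)%N); last by rewrite -expnM pow_le.
  by apply/absz_le/tau_bound; rewrite (@ltn_exp2l p 0 2) // prime_gt1.
pose box := [seq (n, nb) | n <- L, nb <- [seq (n, b) | n <- L, b <- [:: true; false]]].
have -> : (size L * (size L).*2)%N = size box by rewrite !size_allpairs /= muln2.
rewrite -(size_map phi); apply: uniq_leq_size.
  rewrite map_inj_in_uniq; first by apply: filter_uniq; exact: iota_uniq.
  move=> p q pT qT e; have [pp _ _] := Tp _ pT; have [qp _ _] := Tp _ qT.
  have := phiE _ pp; rewrite e -(phiE _ qp) => /eqP.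
  by rewrite eqrXn2 // => /eqP[].
move=> _ /mapP[p pT ->]; have [L1 L2] := TL _ pT.
apply/allpairsP; exists (phi p); split => //.
apply/allpairsP; exists (phi p).2; split => //.
by case: (phi p).2.2.
Qed.

Definition cubic_product (n : nat) (C : pred nat) : int :=
  \prod_(p < n | C p) (tau p * tau (p ^ 2)%N * tau (p ^ 3)%N).

Lemma omega_cubic_product n (C : pred nat) m :
  (forall p, C p -> prime p && (tau p != 0)) ->
  (forall p, p \in primes_1mod3 m -> C p /\ (p < n)%N) ->
  exists S, [/\ uniq S, all prime S, size S = omega (cubic_product n C) &
    (size (primes_1mod3 m) <= size (smooth S (m ^ 54)) * (size (smooth S (m ^ 54))).*2)%N].
Proof.
move=> CP mC; pose S := primes `|cubic_product n C|%N; exists S; split => //.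
- exact: primes_uniq.
- by apply/allP => q; rewrite mem_primes => /and3P[].
have prod_neq0 : cubic_product n C != 0.
  rewrite prodf_seq_neq0; apply/allP => p _; apply/implyP => /CP/andP[pp t0].
  by rewrite !mulf_neq0 ?tau_square_neq0 ?tau_cube_neq0.
apply: size_primes_1mod3_smooth => p /mC[Cp pn].
have dvd : (tau p * tau (p ^ 2) * tau (p ^ 3) %| cubic_product n C)%Z.
  by rewrite /cubic_product (bigD1 (Ordinal pn)) //= dvdz_mulr.
have sub (t : int) : (t %| cubic_product n C)%Z -> all (mem S) (primes `|t|%N).
  move=> tC; apply/allP => q; rewrite !mem_primes => /and3P[qp _ qt].
  by rewrite /S inE mem_primes qp absz_gt0 prod_neq0 (dvdn_trans qt) // -dvdzE.
by split; apply: sub; apply: dvdz_trans dvd; [rewrite -mulrA dvdz_mulr|rewrite dvdz_mulr // dvdz_mull].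
Qed.

(** The inequality ln(1 + t) <= t at 1 + t = 1 / 7 gives ln 7 >= 6 / 7. *)
Lemma ln7_lower (R : realType) : 1 / (6 * ln 7) <= 4^-1 :> R.
Proof.
have h : ln (7 : R)^-1 <= 7^-1 - 1.
  have v0 : 0 < 7^-1 :> R by rewrite invr_gt0.
  by rewrite -[X in ln X](subrK 1) addrC le_ln1Dx //; lra.
rewrite lnV ?posrE // in h.
have l7 : 6 / 7 <= ln (7 : R) by move: h; lra.
rewrite div1r lef_pV2 ?posrE ?mulr_gt0 //; lra.
Qed.

(** The choices of d and k make H^d equal to M^(1/8) and, if |S| < c ln M, exp(k |S|) at most
    M^(1/8). The number of pairs is then at most 2 C^2 M^(1/2), which is too small once M >= (2
    C^2)^2. *)
Lemma smooth_growth (R : realType) (c : R) : 0 < c -> exists B : R, forall (M : nat) (S : seq nat),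
  uniq S -> all prime S -> B <= M%:R -> (0 < M)%N ->
  (M < size (smooth S ((M ^ 54) ^ 54)) * (size (smooth S ((M ^ 54) ^ 54))).*2)%N ->
  c * ln M%:R <= (size S)%:R.
Proof.
move=> c0; pose d : R := (8 * 54 * 54)^-1; pose k : R := (8 * c)^-1.
have d0 : 0 < d by rewrite invr_gt0.
have k0 : 0 < k by rewrite invr_gt0 mulr_gt0.
have [C C0 CP] := size_smooth_bound d0 k0.
exists ((2 * C ^+ 2) ^+ 2) => M S uS pS BM M0 many.
rewrite leNgt; apply/negP => small.
have M0' : 0 < M%:R :> R by rewrite ltr0n.
pose r := M%:R `^ 8^-1 : R.
have r0 : 0 < r by rewrite powR_gt0.
have r8 : r ^+ 8 = M%:R by rewrite /r -powR_mulrn ?powR_ge0 // -powRrM mulVf // powRr1 // ltW.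
have Hr : ((M ^ 54) ^ 54)%:R `^ d = r.
  rewrite -expnM natrX -powR_mulrn ?(ltW M0') // -powRrM /r; congr (_ `^ _).
  by rewrite /d natrM; field.
have er : expR (k * (size S)%:R) <= r.
  rewrite /r /powR gt_eqF // ler_expR; apply: (@le_trans _ _ (k * (c * ln M%:R))).
    by rewrite ler_wpM2l // ltW.
  rewrite le_eqVlt; apply/orP; left; apply/eqP; rewrite /k; field.
  by rewrite gt_eqF.
have := CP S ((M ^ 54) ^ 54)%N uS pS; rewrite Hr.
move: many; set N := size _ => many hN.
have N_le : N%:R <= C * r * r.
  by apply: le_trans hN _; rewrite ler_wpM2l // mulr_ge0 // ltW.
have {}many : M%:R < N%:R * (N%:R * 2) :> R by rewrite -!natrM ltr_nat muln2.
have : M%:R < (C * r * r) * ((C * r * r) * 2).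
  apply: lt_le_trans many _; rewrite ler_pM ?mulr_ge0 ?ler_wpM2r //.
have -> : C * r * r * (C * r * r * 2) = (2 * C ^+ 2) * r ^+ 4 by ring.
rewrite -r8 (_ : r ^+ 8 = r ^+ 4 * r ^+ 4); last by ring.
rewrite ltr_pM2r ?exprn_gt0 // => h.
move: BM; rewrite -r8 (_ : r ^+ 8 = (r ^+ 4) ^+ 2); last by ring.
by rewrite leNgt ltrXn2r // ?nnegrE ?exprn_ge0 ?mulr_ge0 // ltW.
Qed.

Theorem theorem2 (R : realType) (eps : R) (heps : 0 < eps) :
  exists x0 : R, forall x : R, x0 <= x ->
    (1 / (6 * ln 7) - eps) * ln x <=
    (omega (\prod_(p < (Num.truncn (x `^ (1 / 3))).+1 |
                   [&& prime p, p%:R < x `^ (1 / 3) & tau p != 0])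
              (tau p * tau (p ^ 2)%N * tau (p ^ 3)%N)))%:R.
Proof.
(* 84 suffices because ln x = 165 ln u, ln u <= 2 ln M and 42 >= 165 / 4, while 1 / (6 ln 7) <= 1 /
   4. *)
have c0 : 0 < 84 :> R by rewrite ltr0n.
have [B BP] := smooth_growth c0.
pose u0 := Num.max 164 (B + 1); exists (u0 `^ 165) => x x_large.
have u0_ge : 164 <= u0 by rewrite le_max lexx.
have x_gt0 : 0 < x by apply: lt_le_trans x_large; rewrite powR_gt0 // (lt_le_trans _ u0_ge).
(* 165 = 3 * 55: then x^(1/3) = u^55 strictly exceeds M^54 for M the integer part of u. *)
pose u := x `^ 165^-1.
have u_large : u0 <= u.
  have -> : u0 = (u0 `^ 165) `^ 165^-1.
    by rewrite -powRrM mulfV // powRr1 // (le_trans _ u0_ge).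
  by rewrite ge0_ler_powR ?nnegrE ?powR_ge0 // ltW.
have u_ge : 164 <= u := le_trans u0_ge u_large.
have u_gt0 : 0 < u by apply: lt_le_trans u_ge.
have lnx : ln x = 165 * ln u by rewrite /u ln_powR mulrA mulfV // mul1r.
have yE : x `^ (1 / 3) = u ^+ 55.
  rewrite -powR_mulrn ?(ltW u_gt0) // /u -powRrM; congr (_ `^ _); lra.
have lnu : 0 <= ln u by rewrite ln_ge0 // (le_trans _ u_ge) // ler1n.
have [M [M_le M_gt M162]] : exists M : nat, [/\ M%:R <= u, u < M%:R + 1 & (162 < M)%N].
  exists (Num.truncn u); split; [by rewrite truncn_le // ltW|by rewrite natr1 truncnS_gt|].
  by rewrite truncn_ge_nat ?(ltW u_gt0) // (le_trans _ u_ge) // ler_nat.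
have M_gt0 : (0 < M)%N by apply: leq_trans M162.
pose Cp p := [&& prime p, p%:R < x `^ (1 / 3) & tau p != 0].
have [|p|S [uS pS sS cnt]] := @omega_cubic_product (Num.truncn (x `^ (1 / 3))).+1 Cp (M ^ 54).
- by move=> p /and3P[-> _ ->].
- rewrite mem_filter mem_iota add0n ltnS => /andP[/andP[pp /eqP p3] pM].
  have py : p%:R < x `^ (1 / 3).
    rewrite yE; apply: (@le_lt_trans _ _ (M%:R ^+ 54)); first by rewrite -natrX ler_nat.
    apply: (@le_lt_trans _ _ (u ^+ 54)); first by rewrite lerXn2r ?nnegrE // ltW.
    by rewrite [u ^+ 55]exprS ltr_pMl ?exprn_gt0 // (lt_le_trans _ u_ge) // ltr1n.
  by rewrite /Cp pp py tau_neq0 // ltnS truncn_ge_nat ?powR_ge0 // ltW.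
rewrite -[omega _]/(omega (cubic_product _ Cp)) -sS.
have key : 84 * ln M%:R <= (size S)%:R :> R.
  apply: (BP M S uS pS _ M_gt0); last exact: leq_trans (many_primes_1mod3 M162) cnt.
  have : B + 1 <= u by rewrite (le_trans _ u_large) // le_max lexx orbT.
  by move=> h; rewrite -(lerD2r 1) (le_trans h) // ltW.
have lnuM : ln u <= 2 * ln M%:R :> R.
  have M1 : 1 <= M%:R :> R by rewrite ler1n.
  have -> : 2 * ln M%:R = ln (M%:R ^+ 2 : R) by rewrite lnXn ?ltr0n // mulr_natl.
  rewrite ler_ln ?posrE ?exprn_gt0 ?ltr0n //; apply: le_trans (ltW M_gt) _.
  have : 2 <= M%:R :> R by rewrite ler_nat (leq_trans _ M162).
  by rewrite expr2; nra.
apply: le_trans key; rewrite lnx.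
apply: (@le_trans _ _ (4^-1 * (165 * ln u))).
  rewrite ler_wpM2r ?mulr_ge0 //; have := ln7_lower R; lra.
lra.
Qed.
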